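(* Let $m\ge n$, and let $D_k$ ($k=1,\dots,n$) and $C_k$ ($k=1,\dots,n-1$) be independent random nonnegative definite Hermitian $p\times p$ matrices such that $$C_k^2\sim\operatorname{LUE}_p(p(n-k)),\qquad D_k^2\sim\operatorname{LUE}_p(p(m-k+1)),$$ and define the block matrix $$Z_n=\begin{pmatrix}D_1&0&&\\C_1&D_2&\ddots&\\&\ddots&\ddots&0\\&&C_{n-1}&D_n\end{pmatrix}.$$ Then the $p\times p$ spectral matrix measure of $L_n=Z_nZ_n^*$ has the same distribution as the ($p\times p$) spectral matrix measure of a $pn\times pn$ random matrix distributed according to $\operatorname{LUE}_{pn}(pm)$.
   Context: $\operatorname{LUE}_N(\gamma)$: law of $GG^*$, where $G$ is an $N\times\gamma$ matrix with independent complex standard normal entries (independent real and imaginary parts, each $\mathcal N(0,1/2)$). Spectral matrix measure of a Hermitian $N\times N$ matrix $X$ ($N\ge p$): the unique nonnegative $p\times p$ matrix measure $\Sigma^X$ supported on the spectrum of $X$ with $(X^k)_{i,j}=\int x^kd\Sigma^X_{i,j}(x)$ for $k\ge0$, $1\le i,j\le p$. *)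

(* Defs.v *)
From HB Require Import structures.
From mathcomp Require Import all_boot all_order all_algebra.
From mathcomp Require Import sesquilinear spectral.
From mathcomp Require Import all_classical all_reals all_analysis.
From mathcomp Require Import measurable_realfun.
From mathcomp Require Import complex.

Set Implicit Arguments.
Unset Strict Implicit.
Unset Printing Implicit Defensive.

Import Order.TTheory GRing.Theory Num.Theory.
Import numFieldNormedType.Exports.

Local Open Scope classical_set_scope.
Local Open Scope ring_scope.
Local Open Scope complex_scope.
Local Open Scope sesquilinear_scope.

HB.instance Definition _ (R : realType) :=
  isPointed.Build R[i] (0 : R[i]).

Section complex_matrices.
Variable R : realType.

(* Nonnegative definite: Hermitian with a nonnegative quadratic form; in the
   order of R[i], 0 <= z means that z is real and nonnegative. *)
Definition psdmx (n : nat) (A : 'M[R[i]]_n) : Prop :=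
  A \is hermsymmx /\ forall v : 'cV[R[i]]_n, 0 <= (v^t* *m A *m v) 0 0.

(* The Borel sigma-algebra of the space of complex matrices, generated by the
   real and imaginary parts of the entries. *)
Definition mx_coord_sets (m n : nat) : set (set 'M[R[i]]_(m, n)) :=
  [set A | exists i j (B : set R), measurable B /\
     (A = [set M : 'M[R[i]]_(m, n) | B (complex.Re (M i j))] \/
      A = [set M : 'M[R[i]]_(m, n) | B (complex.Im (M i j))])].

Definition cmx (m n : nat) : measurableType (@mx_coord_sets m n).-sigma :=
  g_sigma_algebraType (@mx_coord_sets m n).

End complex_matrices.

Section random_elements.
Variable R : realType.
Local Open Scope ereal_scope.

Definition same_law d1 (T1 : measurableType d1) (P1 : probability T1 R)
    d2 (T2 : measurableType d2) (P2 : probability T2 R)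
    d (E : measurableType d) (X : T1 -> E) (Y : T2 -> E) : Prop :=
  [/\ measurable_fun setT X, measurable_fun setT Y &
      forall A, measurable A -> pushforward P1 X A = pushforward P2 Y A].

Definition mutually_independent d (T : measurableType d) (P : probability T R)
    d' (E : measurableType d') (I : finType) (X : I -> T -> E) : Prop :=
  forall (J : {set I}) (A : I -> set E), (forall i, measurable (A i)) ->
    P (\bigcap_(i in [set i | i \in J]) (X i @^-1` A i)) =
    \prod_(i in J) P (X i @^-1` A i).

End random_elements.

Section LUE.
Variable R : realType.

(* The 2 * N * g real and imaginary parts of the entries are independent and
   N(0, 1/2)-distributed; [normal_prob] takes the standard deviation. *)
Definition complex_gaussian_mx d (T : measurableType d) (P : probability T R)
    (N g : nat) (G : T -> 'M[R[i]]_(N, g)) : Prop :=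
  let X (e : 'I_N * 'I_g * bool) (w : T) : R :=
    if e.2 then complex.Re (G w e.1.1 e.1.2)
    else complex.Im (G w e.1.1 e.1.2) in
  [/\ forall e, measurable_fun setT (X e),
      mutually_independent P X &
      forall e (A : set R), measurable A ->
        pushforward P (X e) A = normal_prob 0 (Num.sqrt 2^-1) A].

Definition LUE_distributed d (T : measurableType d) (P : probability T R)
    (N g : nat) (X : T -> 'M[R[i]]_N) : Prop :=
  exists (d' : measure_display) (T' : measurableType d')
         (P' : probability T' R) (G : T' -> 'M[R[i]]_(N, g)),
    complex_gaussian_mx P' G /\
    same_law P P' (X : T -> cmx R N N) (fun w => G w *m (G w)^t*).

End LUE.

Section matrix_measures.
Variable R : realType.
Implicit Types p N : nat.

(* Integral against a signed measure, through its Jordan decomposition. *)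
Definition charge_integral (nu : {charge set R -> \bar R})
    (f : R -> R) : R :=
  let P := cid (Hahn_decomposition nu) in
  let N := cid (projT2 P) in
  Rintegral (jordan_pos (projT2 N)) setT f -
  Rintegral (jordan_neg (projT2 N)) setT f.

(* A p x p matrix measure is given by the real and imaginary parts of its
   entries, which are finite signed Borel measures on R. *)
Definition mm_value p
    (re im : 'I_p -> 'I_p -> {charge set R -> \bar R})
    (B : set R) : 'M[R[i]]_p :=
  \matrix_(i, j) (fine (re i j B) +i* fine (im i j B)).

Record matrix_measure p := MatrixMeasure {
  mm_re : 'I_p -> 'I_p -> {charge set R -> \bar R} ;
  mm_im : 'I_p -> 'I_p -> {charge set R -> \bar R} ;
  _ : forall B : set R, measurable B -> psdmx (mm_value mm_re mm_im B) }.

Definition mm_eval p (S : matrix_measure p) : set R -> 'M[R[i]]_p :=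
  mm_value (mm_re S) (mm_im S).

Definition mm_integral p (S : matrix_measure p) (f : R -> R) : 'M[R[i]]_p :=
  \matrix_(i, j) (charge_integral (mm_re S i j) f +i*
                  charge_integral (mm_im S i j) f).

Lemma mm_zero_subproof p (B : set R) : measurable B ->
  psdmx (mm_value (fun _ _ : 'I_p => czero) (fun _ _ => czero) B).
Proof.
move=> _.
have -> : mm_value (fun _ _ : 'I_p => czero) (fun _ _ => czero) B = 0.
  by apply/matrixP => i j; rewrite !mxE.
split; last by move=> v; rewrite mulmx0 mul0mx mxE.
by rewrite qualifE /= expr0 scale1r; apply/eqP/matrixP => i j;
  rewrite !mxE conjC0.
Qed.

Definition mm_zero p : matrix_measure p := MatrixMeasure (@mm_zero_subproof p).

HB.instance Definition _ p := gen_eqMixin (matrix_measure p).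
HB.instance Definition _ p := gen_choiceMixin (matrix_measure p).
HB.instance Definition _ p := isPointed.Build (matrix_measure p) (mm_zero p).

(* The sigma-algebra on matrix measures generated by the evaluations
   S |-> S(B) at the Borel sets B. *)
Definition mm_eval_sets p : set (set (matrix_measure p)) :=
  [set A | exists (B : set R) (E : set (cmx R p p)),
     [/\ measurable B, measurable E & A = (fun S => mm_eval S B) @^-1` E]].

Definition mmeasurable p : measurableType (@mm_eval_sets p).-sigma :=
  g_sigma_algebraType (@mm_eval_sets p).

Definition spectrum N (X : 'M[R[i]]_N) : set R :=
  [set x | eigenvalue X x%:C].

Definition is_spectral_measure p N (pN : (p <= N)%N) (X : 'M[R[i]]_N)
    (S : matrix_measure p) : Prop :=
  [/\ X \is hermsymmx,
      mm_eval S (~` spectrum X) = 0 &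
      forall (k : nat) (i j : 'I_p),
        (X ^+ k) (widen_ord pN i) (widen_ord pN j) =
        mm_integral S (fun x => x ^+ k) i j].

(* The spectral matrix measure; it is the zero measure, by convention, when X
   is not Hermitian. *)
Definition spectral_measure p N (pN : (p <= N)%N) (X : 'M[R[i]]_N) :
    mmeasurable p :=
  xget (mm_zero p) [set S | is_spectral_measure pN X S].

End matrix_measures.

Section spectral_measure_existence.
Variable R : realType.

(* The charge sum_e e.1 * dirac_(e.2). *)
Fixpoint atomic_charge (s : seq (R * R)) : {charge set R -> \bar R} :=
  if s is (a, x) :: s' then
    cadd (cscale a (charge_of_finite_measure (@dirac _ R x R)))
         (atomic_charge s')
  else czero.

Lemma atomic_chargeE s (B : set R) :
  atomic_charge s B = (\sum_(e <- s) e.1 * \1_B e.2)%:E.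
Proof.
elim: s => [|[a x] s IH]; first by rewrite big_nil.
by rewrite big_cons EFinD -IH.
Qed.

Let set_seq_cons (y : R) t : [set` y :: t] = [set y] `|` [set` t].
Proof.
apply/seteqP; split=> x /=; rewrite inE.
  by case/orP => [/eqP ->|xt]; [left|right].
by case=> [->|xt]; rewrite ?eqxx// xt orbT.
Qed.

Let set_seq_nil : [set` [::] : seq R] = set0.
Proof. by apply/seteqP; split. Qed.

Let measurable_set_seq (t : seq R) : measurable ([set` t] : set R).
Proof.
elim: t => [|y t IH]; first by rewrite set_seq_nil.
by rewrite set_seq_cons; apply: measurableU => //; exact: measurable_set1.
Qed.

Lemma finite_support_integral (mu : {finite_measure set R -> \bar R})
    (s : seq R) (f : R -> R) :
  uniq s -> measurable_fun setT f -> mu (~` [set` s]) = 0%E ->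
  Rintegral mu setT f = \sum_(y <- s) f y * fine (mu [set y]).
Proof.
move=> us mf mu0.
have ms := measurable_set_seq.
have mfE (A : set R) : measurable_fun A f.
  by apply: (measurable_funS measurableT).
have mfE' (A : set R) := (measurable_EFinP A f).2 (mfE A).
have ptE (y : R) : (\int[mu]_(x in [set y]) (f x)%:E)%E =
    (f y * fine (mu [set y]))%:E.
  rewrite (@eq_integral _ _ _ mu _ (cst (f y)%:E)); last first.
    by move=> x; rewrite inE => ->.
  rewrite integral_cst; last exact: measurable_set1.
  by rewrite EFinM fineK// fin_num_measure//; exact: measurable_set1.
have fE (t : seq R) : uniq t ->
    (\int[mu]_(x in [set` t]) (f x)%:E)%E =
    (\sum_(y <- t) f y * fine (mu [set y]))%:E.
  elim: t => [_|y t IH /= /andP[yt ut]].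
    by rewrite set_seq_nil integral_set0 big_nil.
  have dis : [disjoint [set y] & [set` t]]%classic.
    by rewrite disj_set2E; apply/eqP/seteqP; split=> // x [/= ->];
      rewrite (negbTE yt).
  rewrite set_seq_cons integral_setU//.
  by rewrite ptE IH// big_cons EFinD.
have dis : [disjoint [set` s] & ~` [set` s]]%classic.
  by rewrite disj_set2E; apply/eqP; exact: setICr.
rewrite /Rintegral -(setUv [set` s]) integral_setU//; last exact: measurableC.
rewrite fE// null_set_integral ?adde0//; exact: measurableC.
Qed.

Lemma charge_integral_atomic (nu : {charge set R -> \bar R})
    (s : seq (R * R)) (f : R -> R) :
  measurable_fun setT f ->
  (forall B, measurable B -> nu B = (\sum_(e <- s) e.1 * \1_B e.2)%:E) ->
  charge_integral nu f = \sum_(e <- s) e.1 * f e.2.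
Proof.
move=> mf nuE; rewrite /charge_integral.
set P := cid _; set N := cid _.
have nuPN := projT2 N.
rewrite -/N in nuPN *.
set H := projT2 N.
pose t := undup [seq e.2 | e <- s].
have mt := measurable_set_seq t.
have nu0 A : measurable A -> A `<=` ~` [set` t] -> nu A = 0%E.
  move=> mA At; rewrite nuE// big_seq big1// => e es.
  rewrite indicE (_ : _ \in _ = false) ?mulr0//; apply/negP; rewrite inE.
  by move=> /At; apply => /=; rewrite mem_undup; apply/mapP; exists e.
have [[mP _] [mN _] _ _] := H.
have mtC : measurable (~` [set` t] : set R) by exact: measurableC.
have pos0 : jordan_pos H (~` [set` t]) = 0%E.
  rewrite jordan_posE charge.cjordan_posE /crestr0 mem_set//.
  by rewrite /crestr nu0//; exact: measurableI.
have neg0 : jordan_neg H (~` [set` t]) = 0%E.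
  rewrite jordan_negE charge.cjordan_negE /crestr0 mem_set//.
  by rewrite /crestr nu0 ?oppe0//; exact: measurableI.
have ut : uniq t := undup_uniq _.
rewrite (finite_support_integral ut mf pos0).
rewrite (finite_support_integral ut mf neg0).
rewrite -sumrB.
have valE y : fine (jordan_pos H [set y]) - fine (jordan_neg H [set y]) =
    \sum_(e <- s) e.1 * (e.2 == y)%:R.
  have m1 : measurable ([set y] : set R) by exact: measurable_set1.
  have fp := fin_num_measure (jordan_pos H) _ m1.
  have fn := fin_num_measure (jordan_neg H) _ m1.
  have := jordan_decomp H m1; rewrite nuE// /cadd/= cscaleN1/=.
  rewrite -[X in _ = (X + _)%E -> _](fineK fp).
  rewrite -[X in _ = (_ - X)%E -> _](fineK fn).
  rewrite -EFinB => -[<-]; apply: eq_bigr => e _.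
  rewrite indicE; congr (_ * (nat_of_bool _)%:R).
  by apply/idP/idP; rewrite inE /= => /eqP.
under eq_bigr do rewrite -mulrBr valE mulr_sumr.
rewrite exchange_big/= big_seq [RHS]big_seq; apply: eq_bigr => e es.
have et : e.2 \in t by rewrite mem_undup map_f.
rewrite (bigD1_seq e.2) ?undup_uniq//= eqxx mulr1 mulrC big1 ?addr0// => y.
by rewrite eq_sym => /negbTE ->; rewrite !mulr0.
Qed.

Lemma spectral_measureP p N (pN : (p <= N)%N) (X : 'M[R[i]]_N) :
  X \is hermsymmx -> is_spectral_measure pN X (spectral_measure pN X).
Proof.
move=> Xh; rewrite /spectral_measure.
suff [S HS] : exists S : matrix_measure R p, is_spectral_measure pN X S.
  by case: xgetP => [_ -> //|/(_ S)].
pose U := spectralmx X; pose l := spectral_diag X.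
have UU : U *m U^t* = 1%:M by exact/unitarymxP/spectral_unitarymx.
have UU' : U^t* *m U = 1%:M by exact: mulmx1C.
have iU : invmx U = U^t*.
  have [uU _] := mulmx1_unit UU.
  by rewrite -[LHS]mulmx1 -UU mulmxA mulVmx ?mul1mx.
have XE : X = U^t* *m diag_mx l *m U.
  by rewrite -iU; apply/orthomx_spectralP/hermitian_normalmx.
have lreal a : l 0 a = (complex.Re (l 0 a))%:C.
  have /mxOverP/(_ 0 a) := hermitian_spectral_diag_real Xh.
  by move=> /RRe_real.
pose r a := complex.Re (l 0 a).
have XkE k i j : (X ^+ k) i j = \sum_a (r a ^+ k)%:C * ((U a i)^* * U a j).
  have -> : X ^+ k = U^t* *m diag_mx (\row_a (l 0 a ^+ k)) *m U.
    elim: k => [|k IH].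
      rewrite expr0 (_ : diag_mx _ = 1%:M) ?mulmx1 ?UU'//.
      by apply/matrixP => a b; rewrite !mxE expr0.
    rewrite exprS IH {1}XE -[_ * _]/(_ *m _).
    rewrite !mulmxA -(mulmxA _ U) UU mulmx1 -(mulmxA _ (diag_mx l)).
    rewrite mulmx_diag; congr (_ *m diag_mx _ *m _).
    by apply/rowP => a; rewrite !mxE exprS.
  rewrite !mxE; apply: eq_bigr => a _; rewrite mul_mx_diag !mxE.
  by rewrite lreal rmorphXn/= mulrAC mulrC mulrA -mulrA mulrC.
pose w (i j : 'I_p) a := (U a (widen_ord pN i))^* * U a (widen_ord pN j).
pose sre i j := [seq (complex.Re (w i j a), r a) | a <- index_enum 'I_N].
pose sim i j := [seq (complex.Im (w i j a), r a) | a <- index_enum 'I_N].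
pose cre i j := atomic_charge (sre i j).
pose cim i j := atomic_charge (sim i j).
have valE (B : set R) : mm_value cre cim B =
    \matrix_(i, j) \sum_a (\1_B (r a))%:C * w i j a.
  apply/matrixP => i j; rewrite !mxE !atomic_chargeE/= !big_map/=.
  apply/eqP; rewrite eq_complex/= !raddf_sum/=; apply/andP; split;
    apply/eqP/eq_bigr => a _; case: (w i j a) => u v /=;
    by rewrite mul0r ?subr0 ?addr0 mulrC.
have psd (B : set R) : measurable B -> psdmx (mm_value cre cim B).
  move=> _; rewrite valE; split.
    apply/is_hermitianmxP; rewrite expr0 scale1r; apply/matrixP => i j.
    rewrite !mxE rmorph_sum; apply: eq_bigr => a _.
    by rewrite !rmorphM/= conjCK conj_Creal ?complex_real// [X in _ = _ * X]mulrC.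
  move=> v; pose q a := \sum_j U a (widen_ord pN j) * v j 0.
  suff -> : (v^t* *m (\matrix_(i, j) \sum_a (\1_B (r a))%:C * w i j a) *m v) 0 0
      = \sum_a (\1_B (r a))%:C * ((q a)^* * q a).
    apply: sumr_ge0 => a _; apply: mulr_ge0.
      by rewrite ler0c.
    by rewrite mulrC mul_conjC_ge0.
  rewrite mxE; under eq_bigr do rewrite mxE mulr_suml.
  under eq_bigr do under eq_bigr do rewrite !mxE mulr_sumr mulr_suml.
  under eq_bigr do rewrite exchange_big/=.
  rewrite exchange_big/=; apply: eq_bigr => a _.
  rewrite /q rmorph_sum/= mulr_sumr mulr_sumr; apply: eq_bigr => j _.
  rewrite mulr_suml mulr_sumr; apply: eq_bigr => i _.
  rewrite /w rmorphM/=.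
  rewrite !mulrA; congr (_ * _ * _); rewrite -!mulrA mulrCA.
  by congr (_ * _); rewrite mulrC.
exists (MatrixMeasure psd); split=> //.
- rewrite /mm_eval/= valE; apply/matrixP => i j; rewrite !mxE big1// => a _.
  rewrite indicE (_ : _ \in _ = false) ?mul0r//; apply/negP; rewrite inE.
  apply => /=; rewrite /spectrum/= (_ : (r a)%:C = l 0 a) -?lreal//.
  apply/eigenvalueP.
  exists (row a U).
    rewrite {1}XE rowE !mulmxA -(mulmxA _ U) UU mulmx1.
    by rewrite -(rowE a (diag_mx l)) row_diag_mx -scalemxAl.
  apply/eqP => /(congr1 (fun z => z *m U^t*)).
  rewrite rowE -mulmxA UU mulmx1 mul0mx => /matrixP/(_ 0 a).
  by rewrite !mxE !eqxx => /eqP; rewrite oner_eq0.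
- move=> k i j; rewrite XkE mxE/=.
  have mX : measurable_fun [set: R] (fun x : R => x ^+ k).
    exact: measurable_funX.
  rewrite (charge_integral_atomic (s := sre i j))//; last first.
    by move=> B _; rewrite atomic_chargeE.
  rewrite (charge_integral_atomic (s := sim i j))//; last first.
    by move=> B _; rewrite atomic_chargeE.
  rewrite !big_map/=.
  apply/eqP; rewrite eq_complex/= !raddf_sum/=; apply/andP; split;
    apply/eqP/eq_bigr => a _; rewrite -/(w i j a); case: (w i j a) => u v /=;
    by rewrite mul0r ?subr0 ?addr0 mulrC.
Qed.

End spectral_measure_existence.

Section block_bidiagonal.
Variable R : realType.

Lemma leq_sum_block p n : (0 < n)%N -> (p <= \sum_(i < n) p)%N.
Proof. by move=> n0; rewrite sum_nat_const card_ord leq_pmull. Qed.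

(* The n x n lower bidiagonal block matrix with diagonal blocks
   D 1, ..., D n and subdiagonal blocks C 1, ..., C (n - 1); block indices
   start at 0. *)
Definition block_bidiag p n (D C : nat -> 'M[R[i]]_p) :
    'M[R[i]]_(\sum_(i < n) p) :=
  \mxblock_(i < n, j < n)
    (if i == j then D i.+1 else if i == j.+1 :> nat then C j.+1 else 0).

End block_bidiagonal.

(* Main.v *)
Require Import Defs.
From HB Require Import structures.
From mathcomp Require Import all_boot all_order all_algebra.
From mathcomp Require Import sesquilinear spectral.
From mathcomp Require Import all_classical all_reals all_analysis.
From mathcomp Require Import measurable_realfun complex.
From mathcomp Require Import ring lra.

(** The spectral measure of X sees only the spectrum of X and the p x p corners
    of its powers. It is therefore unchanged when X is replaced by V X V^* with V
    unitary and fixing the first p basis vectors (spectral_measure_conj), and it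
    suffices to compare the probabilities that Z Z^* and G G^* give to measurable
    sets F invariant under these conjugations, where G is a pn x pm complex
    Gaussian matrix.

    This comparison (bidiag_gram_law) is an induction on the number of blocks,
    which brings G to block bidiagonal form. Freeze the top p rows a of G. Some
    unitary Q gives a Q = [s, 0], with s the square root of a a^*; it changes
    neither G G^* nor the Gaussian law of the other rows, which are independent of
    a (freeze_top). Write these rows as [b, g] and freeze b. Some unitary V maps b
    to a matrix that carries the square root c of b^* b in its first p rows and 0
    below; it does not change the law of g, and it acts on G G^* by a conjugation
    that fixes the corner (freeze_bottom_left). What is left is a block lower
    triangular matrix with corner s, off-diagonal block c and lower right block g.
    As g is again Gaussian and independent of (s, c), the induction hypothesis
    replaces g g^* by the Gram matrix of a smaller block bidiagonal matrix. The
    squares of s and of c are Wishart matrices of the sizes prescribed for the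
    first diagonal and subdiagonal blocks, and a nonnegative matrix is determined
    by its square.

    Since a and b are frozen by Fubini (independent2_fubini), Q and V may depend
    on them in a non-measurable way. They come from the fact that two matrices
    with the same Gram matrix differ by a unitary factor (gram_unitary).

    Three further ingredients are built from the ground up. Unitary invariance of
    complex Gaussian matrices: orthogonal matrices are reduced to the identity by
    plane rotations, the rotation of a pair of independent normal variables leaves
    their joint density invariant, and Lebesgue measure is preserved because a
    rotation is a product of three shears (integral_rotate,
    gaussian_family_orthogonal). Measurability of the square root and of the
    spectral measure: for every indicator of a Borel set and every nonnegative
    Borel function, the functional calculus is a measurable function of the
    matrix (calc_measurable_indic, calc_measurable_borel). Uniqueness of the
    spectral measure: its value on B is the corner of 1_B (X), by polynomial
    interpolation on the spectrum (mm_eval_spectral_measure). *)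

Set Implicit Arguments.
Unset Strict Implicit.
Unset Printing Implicit Defensive.
Import Order.TTheory GRing.Theory Num.Theory.
Import numFieldNormedType.Exports.
Local Open Scope classical_set_scope.
Local Open Scope ring_scope.
Local Open Scope complex_scope.
Local Open Scope sesquilinear_scope.

(** * Matrices over a numerically closed field *)

Section gram.
Variable C : numClosedFieldType.

Lemma adjmxM m n p (A : 'M[C]_(m, n)) (B : 'M[C]_(n, p)) :
  (A *m B)^t* = B^t* *m A^t*.
Proof. by rewrite trmx_mul map_mxM. Qed.

Lemma adjmxD m n (A B : 'M[C]_(m, n)) : (A + B)^t* = A^t* + B^t*.
Proof. by rewrite raddfD/= map_mxD. Qed.

Lemma adjmx1 n : (1%:M : 'M[C]_n)^t* = 1%:M.
Proof. by rewrite trmx1 map_mx1. Qed.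

Lemma adjmx0 m n : (0 : 'M[C]_(m, n))^t* = 0.
Proof. by rewrite trmx0 map_mx0. Qed.

Lemma mulmx_adj_eq0 m n (A : 'M[C]_(m, n)) : A *m A^t* = 0 -> A = 0.
Proof.
move=> A0; apply/matrixP => i j; rewrite mxE; apply/eqP.
have /matrixP/(_ i i) := A0; rewrite !mxE => /eqP.
rewrite psumr_eq0 => [|k _]; last by rewrite !mxE mul_conjC_ge0.
by move=> /allP/(_ j); rewrite mem_index_enum !mxE mul_conjC_eq0 => /(_ isT).
Qed.

Lemma unitarymx_adj n (Q : 'M[C]_n) : Q \is unitarymx -> Q^t* *m Q = 1%:M.
Proof. by move=> /unitarymxP QQ; exact: mulmx1C. Qed.

Lemma unitary_conjM n (U A B : 'M[C]_n) : U \is unitarymx ->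
  (U^t* *m A *m U) *m (U^t* *m B *m U) = U^t* *m (A *m B) *m U.
Proof.
by move=> /unitarymxP UU; rewrite !mulmxA -(mulmxA _ U) UU mulmx1.
Qed.

Lemma unitary_conjK n (V X : 'M[C]_n) : V \is unitarymx ->
  V^t* *m (V *m X *m V^t*) *m V = X.
Proof.
by move=> uV; rewrite !mulmxA (unitarymx_adj uV) mul1mx mulmxKtV.
Qed.

Lemma conj_compress n q (V M : 'M[C]_n) (E : 'M[C]_(n, q)) : V^t* *m E = E ->
  E^t* *m (V *m M *m V^t*) *m E = E^t* *m M *m E.
Proof.
move=> VE; have VE' : E^t* *m V = E^t* by rewrite -{2}VE adjmxM trmxCK.
by rewrite !mulmxA VE' -mulmxA VE.
Qed.

(** The missing rows W are an orthonormal basis of the orthogonal complement of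
    the row space of U. *)
Lemma unitary_completion r k n (U : 'M[C]_(r, n)) : (r + k = n)%N ->
  U *m U^t* = 1%:M ->
  exists W : 'M[C]_(k, n),
    [/\ W *m W^t* = 1%:M, U *m W^t* = 0 & U^t* *m U + W^t* *m W = 1%:M].
Proof.
move=> rkn UU.
have [W WW UW] : exists2 W : 'M[C]_(k, n), W *m W^t* = 1%:M & U *m W^t* = 0.
  pose V := orthomx Num.Def.conjC (mx_of_hermitian (hermitian1mx n)) U.
  have rV : \rank V = k.
    have /mxrank_unitary rU : U \is unitarymx by apply/unitarymxP.
    by rewrite rank_ortho rU -rkn addKn.
  have sV : (schmidt (row_base V) <= V)%MS.
    by rewrite eqmx_schmidt_free ?row_base_free// eq_row_base.
  have uV : schmidt (row_base V) \is unitarymx.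
    by rewrite schmidt_unitarymx// rank_leq_col.
  have oV : U *m (schmidt (row_base V))^t* = 0.
    have /orthomx1P VU := sV.
    by rewrite -[LHS]trmxCK adjmxM trmxCK VU adjmx0.
  move: (schmidt (row_base V)) uV oV; rewrite rV => W /unitarymxP WW UW.
  by exists W.
exists W; split=> //; case: _ / rkn in U W UU WW UW *.
have WU : W *m U^t* = 0 by rewrite -[LHS]trmxCK adjmxM trmxCK UW adjmx0.
have : col_mx U W *m row_mx (U^t*) (W^t*) = 1%:M.
  by rewrite mul_col_row UU WW UW WU -scalar_mx_block.
by move=> /mulmx1C; rewrite mul_row_col.
Qed.

(** The coefficients S that orthonormalise a basis of the rows of A also
    orthonormalise the corresponding rows of B, because the Gram matrices agree.
    Both orthonormal systems are completed to orthonormal bases, and Q maps the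
    first basis to the second. *)
Lemma gram_unitary m n (A B : 'M[C]_(m, n)) : A *m A^t* = B *m B^t* ->
  exists2 Q : 'M[C]_n, Q \is unitarymx & A *m Q = B.
Proof.
move=> AB; set r := \rank A.
have rn : (r <= n)%N by exact: rank_leq_col.
pose U := schmidt (row_base A).
have eU : (U :=: A)%MS.
  by apply: eqmx_trans (eq_row_base A); apply: eqmx_schmidt_free; exact: row_base_free.
have UU : U *m U^t* = 1%:M by apply/unitarymxP; exact: schmidt_unitarymx.
pose S := U *m pinvmx A; pose L := A *m pinvmx U.
have US : S *m A = U by rewrite mulmxKpV// eU.
have AL : L *m U = A by rewrite mulmxKpV// eU.
pose V := S *m B.
have VV : V *m V^t* = 1%:M.
  by rewrite adjmxM mulmxA -(mulmxA S) -AB -mulmxA -mulmxA -adjmxM mulmxA US.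
have BL : L *m V = B.
  apply/eqP; rewrite -subr_eq0; apply/eqP/mulmx_adj_eq0.
  have E (X : 'M[C]_(m, n)) : L *m (S *m X) - X = (L *m S - 1%:M) *m X.
    by rewrite mulmxBl mul1mx mulmxA.
  rewrite /V E adjmxM mulmxA -(mulmxA _ B) -AB mulmxA -mulmxA -adjmxM -E.
  by rewrite US AL subrr mul0mx.
clearbody V U.
have [W [WW UW UW1]] := unitary_completion (subnKC rn) UU.
have [X [XX VX VX1]] := unitary_completion (subnKC rn) VV.
have XV : X *m V^t* = 0 by rewrite -[LHS]trmxCK adjmxM trmxCK VX adjmx0.
exists (U^t* *m V + W^t* *m X).
  apply/unitarymxP; rewrite adjmxD !adjmxM !trmxCK mulmxDl !mulmxDr !mulmxA.
  rewrite -!(mulmxA _ V) -!(mulmxA _ X) VV XX VX XV !mulmx0 !mul0mx !mulmx1.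
  by rewrite addr0 add0r.
rewrite -{1}AL mulmxDr !mulmxA -!(mulmxA L U) UU UW mulmx1 mulmx0 mul0mx addr0.
exact: BL.
Qed.

Lemma hermsymmx_spectralE n (A : 'M[C]_n) : A \is hermsymmx ->
  A = (spectralmx A)^t* *m diag_mx (spectral_diag A) *m spectralmx A.
Proof.
move=> /hermitian_normalmx/orthomx_spectralP {1}->.
by rewrite invmx_unitary ?spectral_unitarymx.
Qed.

End gram.

(** * Independence and grouping *)

Section independence.
Context d (T : measurableType d) (R : realType) (P : probability T R).

(** Uniqueness of measures on a pi-system, applied to A |-> P (A `&` B) and
    A |-> P A * P B. *)
Lemma independent_pi_system (G : set (set T)) (B : set T) :
  setI_closed G -> G `<=` measurable -> G setT -> measurable B ->
  (forall A, G A -> P (A `&` B) = (P A * P B)%E) ->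
  forall A, <<s G >> A -> P (A `&` B) = (P A * P B)%E.
Proof.
move=> GI Gm GT mB GB A sGA.
have pB0 : 0 <= fine (P B) by exact: fine_ge0.
pose r : {nonneg R} := NngNum pB0.
have rE C : mscale r P C = (P B * P C)%E.
  by rewrite /mscale /= fineK// fin_num_measure.
suff : mrestr P mB A = mscale r P A by rewrite rE muleC.
apply: (@g_sigma_algebra_measure_unique _ R T G Gm (fun=> setT)) => //.
- by rewrite bigcup_const//; exists 0%N.
- by move=> C GC; apply: etrans (esym (rE C)); rewrite [RHS]muleC; exact: GB.
- by move=> k; rewrite /= /mrestr setTI -ge0_fin_numE ?measure_ge0// fin_num_measure.
Qed.

Context d' (E : measurableType d') (I : finType) (X : I -> T -> E).

Definition cylinders (J : {set I}) : set (set T) :=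
  [set B | exists A : I -> set E, (forall i, measurable (A i)) /\
     B = \bigcap_(i in [set i | i \in J]) (X i @^-1` A i)].

Definition generated_by (J : {set I}) : set (set T) := <<s cylinders J >>.

Hypothesis mX : forall i, measurable_fun setT (X i).

Lemma cylindersT J : cylinders J setT.
Proof.
exists (fun=> setT); split=> //; apply/seteqP; split=> // w _ i _ //.
Qed.

Lemma cylindersI J : setI_closed (cylinders J).
Proof.
move=> _ _ [A [mA ->]] [B [mB ->]]; exists (fun i => A i `&` B i).
split; first by move=> i; exact: measurableI.
apply/seteqP; split => [w [Aw Bw] i Ji|w ABw]; first by split; [exact: Aw|exact: Bw].
by split=> i Ji; have [] := ABw i Ji.
Qed.

Lemma cylinders_measurable J : cylinders J `<=` measurable.
Proof.
move=> _ [A [mA ->]]; apply: fin_bigcap_measurable; first exact: finite_finset.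
by move=> i _; rewrite -[_ @^-1` _]setTI; exact: mX.
Qed.

Lemma generated_by_measurable J : generated_by J `<=` measurable.
Proof.
move=> A; apply: smallest_sub; first exact: sigma_algebra_measurable.
exact: cylinders_measurable.
Qed.

Lemma generated_by_preimage (J : {set I}) j (A : set E) :
  j \in J -> measurable A -> generated_by J (X j @^-1` A).
Proof.
move=> Jj mA; apply: sub_gen_smallest.
exists (fun i => if i == j then A else setT); split; first by move=> i; case: ifP.
apply/seteqP; split=> [w Aw i _|w /(_ j Jj)] /=; last by rewrite eqxx.
by case: eqP => // ->.
Qed.

(** The product rule holds for two cylinders by definition of mutual
    independence; the pi-lambda theorem extends it to one argument at a time. *)
Lemma independent_groups (J K : {set I}) (A B : set T) :
  mutually_independent P X -> [disjoint J & K]%B ->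
  generated_by J A -> generated_by K B -> P (A `&` B) = (P A * P B)%E.
Proof.
move=> iX JK gA gB.
have mB := generated_by_measurable gB.
apply: (independent_pi_system (@cylindersI J) (@cylinders_measurable J)
  (cylindersT J) mB _ gA) => {gA}A cA.
have mA := cylinders_measurable cA.
rewrite setIC muleC.
apply: (independent_pi_system (@cylindersI K) (@cylinders_measurable K)
  (cylindersT K) mA _ gB) => {gB mB}B cB.
case: cA cB => A1 [mA1 AE] [B1 [mB1 BE]].
pose C i := if i \in J then A1 i else B1 i.
have mC i : measurable (C i) by rewrite /C; case: ifP.
have CE : B `&` A = \bigcap_(i in [set i | i \in J :|: K]) (X i @^-1` C i).
  rewrite AE BE; apply/seteqP; split => [w [Bw Aw] i|w Cw].
    rewrite /= inE /C => /orP[] ij; first by rewrite ij; exact: Aw.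
    by rewrite (disjointFl JK ij); exact: Bw.
  have Cw' i : (i \in J) || (i \in K) -> C i (X i w).
    by move=> ij; apply: Cw; rewrite /= inE.
  split=> i /= ij; move: (Cw' i); rewrite ij ?orbT /C => /(_ isT).
    by rewrite (disjointFl JK ij).
  by rewrite ij.
rewrite CE iX// (big_setID K)/=; congr (_ * _)%E.
  rewrite BE iX//; apply: eq_big => [i|i].
    by rewrite !inE; case: (i \in K); rewrite ?orbT ?andbF.
  by rewrite !inE => /andP[_ ik]; rewrite /C (disjointFl JK ik).
rewrite AE iX//; apply: eq_big => [i|i].
  rewrite !inE; case: (boolP (i \in K)) => ik; last by rewrite orbF.
  by rewrite (disjointFl JK ik).
by rewrite !inE => /andP[ik]; rewrite (negbTE ik) orbF /C => ->.
Qed.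

End independence.

Section independence_corollaries.
Context d (T : measurableType d) (R : realType) (P : probability T R).

Lemma independent_reindex d' (E : measurableType d') (I I' : finType)
    (X : I -> T -> E) (f : I' -> I) :
  injective f -> mutually_independent P X ->
  mutually_independent P (fun i => X (f i)).
Proof.
move=> fI iX J A mA.
pose A' i := if [pick j | f j == i] is Some j then A j else setT.
have A'f j : A' (f j) = A j.
  rewrite /A'; case: pickP => [k /eqP/fI -> //|/(_ j)].
  by rewrite eqxx.
have mA' i : measurable (A' i) by rewrite /A'; case: pickP.
have := iX (f @: J)%SET A' mA'.
rewrite big_imset/=; last by move=> ? ? _ _; exact: fI.
under [X in _ = X]eq_bigr do rewrite A'f; move=> <-; congr (P _).
apply/seteqP; split => w Aw i /=.
  by move=> /imsetP[j Jj ->]; rewrite A'f; exact: Aw.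
by move=> Ji; have := Aw (f i); rewrite /= A'f; apply; exact: imset_f.
Qed.

Lemma generated_by_fun d' (E : measurableType d') (I : finType)
    (X : I -> T -> E) (J : {set I}) d2 (E2 : measurableType d2) (Y : T -> E2) :
  measurable_fun setT (Y : g_sigma_algebraType (cylinders X J) -> E2) ->
  forall B, measurable B -> generated_by X J (Y @^-1` B).
Proof.
by move=> mY B mB; have := mY measurableT B mB; rewrite setTI.
Qed.

Lemma measurable_generated_by d' (E : measurableType d') (I : finType)
    (X : I -> T -> E) (J : {set I}) j : j \in J ->
  measurable_fun setT (X j : g_sigma_algebraType (cylinders X J) -> E).
Proof.
by move=> Jj _ A mA; rewrite setTI; exact: generated_by_preimage.
Qed.

Definition independent2 d1 d2 (E1 : measurableType d1) (E2 : measurableType d2)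
    (X : T -> E1) (Y : T -> E2) :=
  forall A B, measurable A -> measurable B ->
    P (X @^-1` A `&` Y @^-1` B) = (P (X @^-1` A) * P (Y @^-1` B))%E.

Section pair.
Context d1 d2 (E1 : measurableType d1) (E2 : measurableType d2).
Variables (X : T -> E1) (Y : T -> E2).
Hypotheses (mX : measurable_fun setT X) (mY : measurable_fun setT Y).

Lemma independent2_product (m1 : {sigma_finite_measure set E1 -> \bar R})
    (m2 : {sigma_finite_measure set E2 -> \bar R}) (F : set (E1 * E2)) :
  independent2 X Y ->
  (forall A, measurable A -> P (X @^-1` A) = m1 A) ->
  (forall B, measurable B -> P (Y @^-1` B) = m2 B) ->
  measurable F -> P [set w | F (X w, Y w)] = (m1 \x m2)%E F.
Proof.
move=> iXY l1 l2 mF.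
pose Z (w : T) : (E1 * E2)%type := (X w, Y w).
have mZ : measurable_fun setT Z by exact: measurable_fun_pair.
pose Z' : {mfun T >-> (E1 * E2)%type} :=
  HB.pack Z (isMeasurableFun.Build _ _ _ _ _ mZ).
apply: esym; apply: (@product_measure_unique _ _ _ _ R m1 m2
  (distribution P Z')) => // A B mA mB.
by rewrite -l1// -l2//; exact: iXY.
Qed.

(** Conditioning on X amounts to freezing it: an identity that holds for each
    frozen value may use auxiliary matrices that depend on this value in a
    non-measurable way. *)
Lemma independent2_fubini (F : set (E1 * E2)) :
  independent2 X Y -> measurable F ->
  P [set w | F (X w, Y w)] =
  (\int[P]_w P [set w' | F (X w, Y w')])%E.
Proof.
move=> iXY mF.
pose X' : {mfun T >-> E1} := HB.pack X (isMeasurableFun.Build _ _ _ _ _ mX).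
pose Y' : {mfun T >-> E2} := HB.pack Y (isMeasurableFun.Build _ _ _ _ _ mY).
have mF' := measurable_fun_xsection (distribution P Y') mF.
rewrite (@independent2_product (distribution P X') (distribution P Y'))//.
rewrite /product_measure1 ge0_integral_pushforward//.
apply: eq_integral => w _ /=; rewrite /pushforward; congr (P _).
by apply/seteqP; split => v; rewrite /xsection /= inE.
Qed.

End pair.

End independence_corollaries.

(** * Rotation invariance of a pair of normal variables *)

Section rotation_invariance.
Variable R : realType.
Local Notation mu := (@lebesgue_measure R).
Local Notation RR := (measurableTypeR R).
Implicit Types (t : R) (f : RR * RR -> \bar R).

Lemma integral_translate (f : RR -> \bar R) t :
  measurable_fun setT f -> (forall x, 0 <= f x)%E ->
  (\int[mu]_x f (x + t)%R = \int[mu]_x f x)%E.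
Proof.
move=> mf f0.
have mt : measurable_fun setT ((fun x => x + t) : RR -> RR).
  exact: measurable_funD.
have -> : (\int[mu]_x f x = \int[pushforward mu (fun x : RR => (x + t)%R : RR)]_x f x)%E.
  apply: eq_measure_integral => A mA _; apply: lebesgue_measure_unique => //=.
  move=> _ [[a b]] _ <-; rewrite /pushforward.
  rewrite (_ : _ @^-1` _ = `](a - t), (b - t)]%classic); last first.
    apply/seteqP; split => x /=; rewrite !in_itv/=; lra.
  rewrite !lebesgue_measure_itv/= !lte_fin ltrD2r; case: ifP => // _.
  by congr EFin; ring.
by rewrite ge0_integral_pushforward// => *; exact: f0.
Qed.

Lemma integral_shear1 f t :
  measurable_fun setT f -> (forall z, 0 <= f z)%E ->
  (\int[mu \x mu]_z f (z.1 + t * z.2, z.2)%R = \int[mu \x mu]_z f z)%E.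
Proof.
move=> mf f0.
have ms : measurable_fun setT (fun z : RR * RR => (z.1 + t * z.2, z.2)).
  apply: measurable_fun_pair => //; apply: measurable_funD => //.
  exact: measurable_funM.
rewrite fubini_tonelli2//=; last exact: measurableT_comp ms.
rewrite [RHS](fubini_tonelli2 f mf f0); apply: eq_integral => y _; rewrite /fubini_G/=.
by rewrite (@integral_translate (fun x => f (x, y)))//; exact: measurableT_comp.
Qed.

Lemma integral_shear2 f t :
  measurable_fun setT f -> (forall z, 0 <= f z)%E ->
  (\int[mu \x mu]_z f (z.1, z.2 + t * z.1)%R = \int[mu \x mu]_z f z)%E.
Proof.
move=> mf f0.
have ms : measurable_fun setT (fun z : RR * RR => (z.1, z.2 + t * z.1)).
  apply: measurable_fun_pair => //; apply: measurable_funD => //.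
  exact: measurable_funM.
rewrite fubini_tonelli1//=; last exact: measurableT_comp ms.
rewrite [RHS](fubini_tonelli1 f mf f0); apply: eq_integral => x _; rewrite /fubini_F/=.
by rewrite (@integral_translate (fun y => f (x, y)))//; exact: measurableT_comp.
Qed.

Definition rotate (c s : R) (z : RR * RR) : RR * RR :=
  (c * z.1 - s * z.2, s * z.1 + c * z.2).

Lemma measurable_rotate c s : measurable_fun setT (rotate c s).
Proof.
by apply: measurable_fun_pair; [apply: measurable_funB|apply: measurable_funD];
  apply: measurable_funM.
Qed.

(** A rotation other than the half turn is a product of three shears, each of
    which preserves the plane Lebesgue measure by Fubini and by translation
    invariance on the line. *)
Lemma integral_rotate f c s : c ^+ 2 + s ^+ 2 = 1 -> c != -1 ->
  measurable_fun setT f -> (forall z, 0 <= f z)%E ->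
  (\int[mu \x mu]_z f (rotate c s z) = \int[mu \x mu]_z f z)%E.
Proof.
move=> cs1 c1 mf f0; have c1' : 1 + c != 0.
  by apply: contra c1 => /eqP H; apply/eqP; lra.
(* t is - tan (a / 2) for the rotation of angle a *)
pose t := - s / (1 + c).
have ts : 1 + t * s = c.
  have s2 : s * s = (1 - c) * (1 + c) by lra.
  by rewrite /t mulrAC mulNr s2 mulNr mulfK//; ring.
have tc : t * (1 + c) = - s by rewrite /t divfK.
have m1 : measurable_fun setT (fun z : RR * RR => (z.1 + t * z.2, z.2)).
  apply: measurable_fun_pair => //; apply: measurable_funD => //.
  exact: measurable_funM.
have m2 : measurable_fun setT (fun z : RR * RR => (z.1, z.2 + s * z.1)).
  apply: measurable_fun_pair => //; apply: measurable_funD => //.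
  exact: measurable_funM.
have mf1 := measurableT_comp mf m1; have mf2 := measurableT_comp mf1 m2.
rewrite -(integral_shear1 t mf f0).
rewrite -(integral_shear2 s mf1) ?(_ : forall z, 0 <= _ z)%E; last by move=> z; exact: f0.
rewrite -(integral_shear1 t mf2) ?(_ : forall z, 0 <= _ z)%E; last by move=> z; exact: f0.
apply: eq_integral => -[x y] _ /=; congr f; rewrite /rotate/=.
have -> : y + s * (x + t * y) = s * x + c * y by rewrite -{1}ts; ring.
congr pair; apply: esym.
transitivity ((1 + t * s) * x + (t * (1 + c)) * y); first by ring.
by rewrite ts tc mulNr.
Qed.

End rotation_invariance.

Section density_measure.
Context d (T : measurableType d) (R : realType) (m : {measure set T -> \bar R}).
Variable f : T -> \bar R.
Hypothesis mf : measurable_fun setT f.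
Hypothesis f0 : forall x, (0 <= f x)%E.

(** The hypotheses on f are arguments, so that the measure structure below can
    be inferred from the term itself. *)
Definition density_measure of measurable_fun setT f & (forall x, (0 <= f x)%E) :=
  fun V : set T => (\int[m]_(x in V) f x)%E.

Local Notation nu := (density_measure mf f0).

Let nu0 : nu set0 = 0%E. Proof. exact: integral_set0. Qed.
Let nu_ge0 V : (0 <= nu V)%E. Proof. exact: integral_ge0. Qed.
Let nu_sigma : semi_sigma_additive nu.
Proof. exact: semi_sigma_additive_nng_induced. Qed.

HB.instance Definition _ := isMeasure.Build _ _ _ nu nu0 nu_ge0 nu_sigma.

End density_measure.

Section normal_rotation.
Variables (R : realType) (sigma : R).
Hypothesis sigma0 : sigma != 0.
Local Notation mu := (@lebesgue_measure R).
Local Notation gam := (normal_prob 0 sigma).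
Local Notation q := (normal_pdf 0 sigma).

Let q2 (z : measurableTypeR R * measurableTypeR R) : \bar R := (q z.1 * q z.2)%:E.

Let mq2 : measurable_fun setT q2.
Proof.
apply/measurable_EFinP; apply: measurable_funM;
  by apply: measurableT_comp => //; exact: measurable_normal_pdf.
Qed.

Let q2_ge0 z : (0 <= q2 z)%E.
Proof. by rewrite lee_fin mulr_ge0// normal_pdf_ge0. Qed.

Let nu := density_measure (mu \x mu)%E mq2 q2_ge0.

Let nuX (A B : set (measurableTypeR R)) : measurable A -> measurable B ->
  nu (A `*` B) = (gam A * gam B)%E.
Proof.
move=> mA mB; rewrite /nu /density_measure integral_mkcond.
pose g (z : R * R) : \bar R := ((q z.1 * \1_A z.1) * (q z.2 * \1_B z.2))%:E.
have -> : (q2 \_ (A `*` B)) = g.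
  apply/funext => -[x y]; rewrite /g /q2 /patch in_setX/= !indicE/=.
  by case: (x \in A); case: (y \in B); rewrite /= ?mulr1 ?mulr0 ?mul0r ?mulr0.
have mqI (C : set R) : measurable C -> measurable_fun setT (fun x => q x * \1_C x).
  by move=> mC; apply: measurable_funM => //; exact: measurable_normal_pdf.
have qI0 (C : set R) x : 0 <= q x * \1_C x by rewrite mulr_ge0 ?normal_pdf_ge0.
have gamE (C : set R) : gam C = (\int[mu]_x (q x * \1_C x)%:E)%E.
  rewrite /gam integral_mkcond; apply: eq_integral => x _.
  by rewrite /patch indicE; case: (x \in C); rewrite /= ?mulr1 ?mulr0.
rewrite fubini_tonelli1//=; last 2 first.
- apply/measurable_EFinP; apply: measurable_funM.
    exact: (measurableT_comp (mqI A mA) measurable_fst).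
  exact: (measurableT_comp (mqI B mB) measurable_snd).
- by move=> z; rewrite lee_fin mulr_ge0.
rewrite /fubini_F/= /g /=.
under eq_integral => x _.
  under eq_integral => y _ do rewrite EFinM.
  rewrite ge0_integralZl//=; last 3 first.
  - by apply/measurable_EFinP; exact: mqI.
  - by move=> y _; rewrite lee_fin.
  - by rewrite lee_fin.
  rewrite -gamE; over.
rewrite ge0_integralZr//=; first by rewrite -gamE.
- by apply/measurable_EFinP; exact: mqI.
- by move=> x _; rewrite lee_fin.
Qed.

(** The joint density of the pair is a function of x ^+ 2 + y ^+ 2. *)
Lemma normal_prob_rotate c s (A B : set (measurableTypeR R)) :
  c ^+ 2 + s ^+ 2 = 1 -> c != -1 -> measurable A -> measurable B ->
  (gam \x gam)%E (rotate c s @^-1` (A `*` B)) = (gam A * gam B)%E.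
Proof.
move=> cs1 c1 mA mB.
have mAB : measurable (A `*` B) by exact: measurableX.
have mE : measurable (rotate c s @^-1` (A `*` B)).
  by rewrite -[_ @^-1` _]setTI; exact: measurable_rotate.
have /= -> := @product_measure_unique _ _ _ _ _ gam gam nu nuX _ mE.
rewrite -nuX// /nu /density_measure integral_mkcond [RHS]integral_mkcond.
have mg : measurable_fun setT (q2 \_ (A `*` B)).
  by apply/(measurable_restrictT q2 mAB); exact: measurable_funTS.
have g0 z : (0 <= (q2 \_ (A `*` B)) z)%E by exact: erestrict_ge0.
rewrite -(integral_rotate cs1 c1 mg g0).
apply: eq_integral => -[x y] _; rewrite /patch.
have -> : ((x, y) \in rotate c s @^-1` (A `*` B)) = (rotate c s (x, y) \in A `*` B).
  by apply/idP/idP; rewrite !inE.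
case: ifP => // _; rewrite /q2/=; congr EFin.
have qE u : q u = normal_peak sigma * expR (- u ^+ 2 / (sigma ^+ 2 *+ 2)).
  by rewrite normal_pdfE// /normal_fun subr0.
rewrite !qE mulrACA -expRD [RHS]mulrACA -expRD; congr (_ * expR _).
rewrite -!mulrDl; congr (_ / _); rewrite /rotate/=; apply: esym.
transitivity (- ((c ^+ 2 + s ^+ 2) * (x ^+ 2 + y ^+ 2))); first by ring.
by rewrite cs1; ring.
Qed.

End normal_rotation.

(** * Orthogonal invariance of Gaussian families *)

Section gaussian_families.
Context d (T : measurableType d) (R : realType) (P : probability T R).
Variable sigma : R.
Hypothesis sigma0 : sigma != 0.
Local Notation gam := (normal_prob 0 sigma).

Definition gaussian_family (I : finType) (X : I -> T -> R) : Prop :=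
  [/\ forall i, measurable_fun setT (X i),
      mutually_independent P X &
      forall i (A : set R), measurable A -> pushforward P (X i) A = gam A].

Lemma normal_prob_setT : gam setT = 1%E.
Proof. exact: probability_setT. Qed.

(** Independence and the laws of the members are packed in one identity, which
    is the form to check for a transformed family. *)
Lemma gaussian_boxP (I : finType) (X : I -> T -> R) :
  (forall i, measurable_fun setT (X i)) ->
  gaussian_family X <->
  (forall A : I -> set R, (forall i, measurable (A i)) ->
     P (\bigcap_i (X i @^-1` A i)) = (\prod_i gam (A i))%E).
Proof.
move=> mX; split=> [[_ iX lX] A mA|box].
  have := iX [set: I]%SET A mA.
  rewrite (_ : [set i | i \in [set: I]%SET] = setT); last first.
    by apply/seteqP; split=> // i _ /=; rewrite inE.
  move=> ->; apply: eq_big => [i|i _]; first by rewrite inE.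
  exact: lX.
have boxJ (J : {set I}) (A : I -> set R) : (forall i, measurable (A i)) ->
    P (\bigcap_(i in [set i | i \in J]) (X i @^-1` A i)) =
    (\prod_(i in J) gam (A i))%E.
  move=> mA; pose A' i := if i \in J then A i else setT.
  have mA' i : measurable (A' i) by rewrite /A'; case: ifP.
  transitivity (P (\bigcap_i (X i @^-1` A' i))).
    congr (P _); apply/seteqP; split => w Aw i /=.
      by move=> _; rewrite /A'; case: ifPn => // Ji; exact: Aw.
    by move=> Ji; have := Aw i Logic.I; rewrite /A' /= Ji.
  rewrite box// [RHS]big_mkcond/=; apply: eq_bigr => i _.
  by rewrite /A'; case: ifP => // _; exact: normal_prob_setT.
have law i (A : set R) : measurable A -> pushforward P (X i) A = gam A.
  move=> mA; have := boxJ [set i]%SET (fun=> A) (fun=> mA).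
  rewrite big_set1 => <-; rewrite /pushforward; congr (P _).
  apply/seteqP; split => w; first by move=> Aw j /=; rewrite inE => /eqP ->.
  by apply; rewrite /= inE.
split=> // J A mA; rewrite boxJ//; apply: eq_bigr => i Ji.
by apply/esym; exact: law.
Qed.

Lemma normal_prob_opp (A : set R) : measurable A -> gam [set x | A (- x)] = gam A.
Proof.
move=> mA; rewrite /normal_prob.
transitivity (\int[pushforward (@lebesgue_measure R)
    (-%R : _ -> measurableTypeR R)]_(x in A) (normal_pdf 0 sigma x)%:E)%E.
  rewrite ge0_integral_pushforward//=; last 2 first.
  - apply: measurable_funTS; apply/measurable_EFinP.
    exact: measurable_normal_pdf.
  - by move=> x _; rewrite lee_fin normal_pdf_ge0.
  apply: eq_integral => x _; rewrite /= !normal_pdfE// /normal_fun !subr0.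
  by rewrite sqrrN.
by apply: eq_measure_integral => B mB _; exact: lebesgue_measureN.
Qed.

Section coordinate_moves.
Variable I : finType.

Definition rotate_coords (i j : I) (c s : R) (x : I -> R) (k : I) : R :=
  if k == i then c * x i - s * x j else if k == j then s * x i + c * x j else x k.

Definition flip_coord (i : I) (x : I -> R) (k : I) : R :=
  if k == i then - x i else x k.

(** The rotation acts on the pair (X i, X j), which is independent of the other
    members, so the box identity splits into the two-dimensional case and the
    remaining product. *)
Lemma gaussian_family_rotate (X : I -> T -> R) i j c s :
  i != j -> c ^+ 2 + s ^+ 2 = 1 -> c != -1 ->
  gaussian_family X ->
  gaussian_family (fun k w => rotate_coords i j c s (X^~ w) k).
Proof.
move=> ij cs1 c1 gX; have [mX iX lX] := gX.
have mY k : measurable_fun setT (fun w => rotate_coords i j c s (X^~ w) k).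
  rewrite /rotate_coords; case: (k == i); [|case: (k == j)].
  - by apply: measurable_funB; apply: measurable_funM.
  - by apply: measurable_funD; apply: measurable_funM.
  - exact: mX.
apply/(gaussian_boxP mY) => A mA.
pose J : {set I} := [set i; j]%SET.
pose Q w : measurableTypeR R * measurableTypeR R := (X i w, X j w).
pose E := rotate c s @^-1` (A i `*` A j).
have mE : measurable E.
  have mAA : measurable (A i `*` A j : set (measurableTypeR R * measurableTypeR R)).
    by apply: measurableX; exact: mA.
  by have := @measurable_rotate R c s measurableT _ mAA; rewrite setTI.
have iJ : i \in J by rewrite !inE eqxx.
have jJ : j \in J by rewrite !inE eqxx orbT.
have mQ : measurable_fun setT (Q : g_sigma_algebraType (cylinders X J) -> _).
  by apply: measurable_fun_pair; exact: measurable_generated_by.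
have gE : generated_by X J (Q @^-1` E) by exact: generated_by_fun mQ _ mE.
have lQ : P (Q @^-1` E) = (gam (A i) * gam (A j))%E.
  rewrite -(normal_prob_rotate sigma0 cs1 c1 (mA i) (mA j)).
  have iQ : independent2 P (X i : T -> measurableTypeR R) (X j : T -> measurableTypeR R).
    move=> B B' mB mB'.
    apply: (independent_groups mX iX (J := [set i]%SET) (K := [set j]%SET)).
    - by rewrite disjoints1 inE.
    - by apply: generated_by_preimage => //; rewrite inE.
    - by apply: generated_by_preimage => //; rewrite inE.
  exact: (@independent2_product _ _ _ P _ _ (measurableTypeR R)
    (measurableTypeR R) (X i) (X j) (mX i) (mX j) gam gam E iQ (lX i) (lX j) mE).
pose C := \bigcap_(k in [set k | k \in (~: J)%SET]) (X k @^-1` A k).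
have gC : generated_by X (~: J)%SET C.
  by apply: sub_gen_smallest; exists A.
transitivity (P (Q @^-1` E `&` C)).
  congr (P _); apply/seteqP; split => w.
    move=> Aw; split; last first.
      move=> k /=; rewrite !inE negb_or => /andP[ki kj].
      by have := Aw k Logic.I; rewrite /= /rotate_coords (negbTE ki) (negbTE kj).
    split; first by have := Aw i Logic.I; rewrite /= /rotate_coords eqxx.
    by have := Aw j Logic.I; rewrite /= /rotate_coords eq_sym (negbTE ij) eqxx.
  move=> [[Ei Ej] Cw] k _; rewrite /= /rotate_coords.
  case: eqP => [->|/eqP ki]; first exact: Ei.
  case: eqP => [->|/eqP kj]; first exact: Ej.
  by apply: Cw; rewrite /= !inE negb_or ki.
rewrite (independent_groups mX iX _ gE gC); last first.
  by rewrite finset.disjoints_subset finset.setCK.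
rewrite lQ iX// [RHS](bigD1 i)//= [in RHS](bigD1 j)/=; last by rewrite eq_sym.
rewrite muleA; congr (_ * _)%E; apply: eq_big => [k|k _]; last exact: lX.
by rewrite !inE negb_or.
Qed.

Lemma gaussian_family_flip (X : I -> T -> R) i :
  gaussian_family X -> gaussian_family (fun k w => flip_coord i (X^~ w) k).
Proof.
move=> gX; have [mX iX lX] := gX.
have mY k : measurable_fun setT (fun w => flip_coord i (X^~ w) k).
  rewrite /flip_coord; case: (k == i) => //.
  exact: measurable_funN.
apply/(gaussian_boxP mY) => A mA; pose A' k := if k == i then [set x | A k (- x)] else A k.
have mA' k : measurable (A' k).
  rewrite /A'; case: ifP => // _.
  have := @oppr_measurable R setT measurableT (A k) (mA k).
  by rewrite setTI.
have /(gaussian_boxP mX)/(_ A' mA') := gX.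
rewrite (_ : \prod_k gam (A' k) = \prod_k gam (A k))%E; last first.
  by apply: eq_bigr => k _; rewrite /A'; case: ifP => // _; exact: normal_prob_opp.
move=> <-; congr (P _); apply/seteqP; split => w Aw k _ /=;
  have := Aw k Logic.I; rewrite /= /A' /flip_coord; case: eqP => [->|] //.
Qed.

End coordinate_moves.

Section orthogonal_invariance.
Variable K : nat.
Implicit Types (O : 'M[R]_K) (X : 'I_K -> T -> R).

Let rotmx i j c s O : 'M[R]_K :=
  \matrix_(k, l) rotate_coords i j c s (fun k => O k l) k.

Let gaussian_stable O := forall X, gaussian_family X ->
  gaussian_family (fun i w => \sum_j O i j * X j w).

Let rotate_coords_inner i j c s (x y : 'I_K -> R) : i != j ->
  c ^+ 2 + s ^+ 2 = 1 ->
  \sum_k rotate_coords i j c s x k * rotate_coords i j c s y k =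
  \sum_k x k * y k.
Proof.
move=> ij cs1; have ji : j != i by rewrite eq_sym.
rewrite (bigD1 i)//= (bigD1 j)//= [RHS](bigD1 i)//= [in RHS](bigD1 j)//=.
rewrite !addrA; congr (_ + _); last first.
  apply: eq_bigr => k /andP[ki kj].
  by rewrite /rotate_coords (negbTE ki) (negbTE kj).
rewrite /rotate_coords !eqxx (negbTE ji).
transitivity ((c ^+ 2 + s ^+ 2) * (x i * y i + x j * y j)); first by ring.
by rewrite cs1 mul1r.
Qed.

Let rotmx_orthogonal i j c s O : i != j -> c ^+ 2 + s ^+ 2 = 1 ->
  O^T *m O = 1%:M -> (rotmx i j c s O)^T *m rotmx i j c s O = 1%:M.
Proof.
move=> ij cs1 OO; rewrite -OO; apply/matrixP => k l; rewrite !mxE.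
under eq_bigr do rewrite !mxE.
by rewrite rotate_coords_inner//; apply: eq_bigr => a _; rewrite !mxE.
Qed.

Let gaussian_stable_rotmx i j c s O : i != j -> c ^+ 2 + s ^+ 2 = 1 -> c != -1 ->
  gaussian_stable (rotmx i j c s O) -> gaussian_stable O.
Proof.
move=> ij cs1 c1 gO X gX; have ji : j != i by rewrite eq_sym.
have cs1' : c ^+ 2 + (- s) ^+ 2 = 1 by rewrite sqrrN.
have := gaussian_family_rotate ij cs1' c1 (gO X gX).
congr gaussian_family; apply/funext => k; apply/funext => w.
have E u : \sum_l rotmx i j c s O u l * X l w =
    rotate_coords i j c s (fun a => \sum_l O a l * X l w) u.
  rewrite /rotate_coords; case: (boolP (u == i)) => ui; [|case: (boolP (u == j)) => uj].
  - rewrite !mulr_sumr -sumrB; apply: eq_bigr => l _.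
    by rewrite mxE /rotate_coords ui; ring.
  - rewrite !mulr_sumr -big_split; apply: eq_bigr => l _.
    by rewrite mxE /rotate_coords (negbTE ui) uj /=; ring.
  - apply: eq_bigr => l _.
    by rewrite mxE /rotate_coords (negbTE ui) (negbTE uj).
rewrite {1}/rotate_coords !E /rotate_coords !eqxx (negbTE ji).
set a := \sum_l O i l * _; set b := \sum_l O j l * _.
case: eqP => [->|_]; [|case: eqP => [->|_//]].
- transitivity ((c ^+ 2 + s ^+ 2) * a); first by ring.
  by rewrite cs1 mul1r.
- transitivity ((c ^+ 2 + s ^+ 2) * b); first by ring.
  by rewrite cs1 mul1r.
Qed.

Let gaussian_stable_flip i O :
  gaussian_stable (\matrix_(k, l) flip_coord i (fun k => O k l) k) -> gaussian_stable O.
Proof.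
move=> gO X gX; have := gaussian_family_flip i (gO X gX).
congr gaussian_family; apply/funext => k; apply/funext => w.
rewrite /flip_coord; case: eqP => [->|/eqP ki].
  rewrite -sumrN; apply: eq_bigr => l _.
  by rewrite mxE /flip_coord eqxx mulNr opprK.
by apply: eq_bigr => l _; rewrite mxE /flip_coord (negbTE ki).
Qed.

Let gaussian_stable1 : gaussian_stable 1%:M.
Proof.
move=> X; congr gaussian_family; apply/funext => k; apply/funext => w.
rewrite (bigD1 k)//= big1 ?mxE ?eqxx ?mul1r ?addr0// => l.
by rewrite mxE eq_sym => /negbTE ->; rewrite mul0r.
Qed.

Let unit_columns r O := forall (k l : 'I_K), (l < r)%N -> O k l = (k == l)%:R.

Let unit_columns_row r O : O^T *m O = 1%:M -> unit_columns r O ->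
  forall k l : 'I_K, (k < r)%N -> O k l = (k == l)%:R.
Proof.
move=> OO uO k l kr; have /matrixP/(_ k l) := OO; rewrite !mxE => <-.
under eq_bigr do rewrite mxE (uO _ k)//.
rewrite (bigD1 k)//= big1 ?addr0 ?eqxx ?mul1r// => i ik.
by rewrite (negbTE ik) mul0r.
Qed.

(** Givens elimination: plane rotations and sign changes clear the columns of
    an orthogonal matrix one after the other. *)
Let gaussian_stable_orthogonal n r O : (n + r = K)%N -> O^T *m O = 1%:M ->
  unit_columns r O -> gaussian_stable O.
Proof.
elim: n r O => [r O|n IH r O].
  rewrite add0n => -> OO uO; rewrite (_ : O = 1%:M); first exact: gaussian_stable1.
  by apply/matrixP => k l; rewrite uO// mxE.
move=> nr OO uO; have rK : (r < K)%N by rewrite -nr addSn ltnS leq_addl.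
pose q := Ordinal rK.
(* column r is cleared below the diagonal, one entry of s at a time *)
suff H : forall s : seq 'I_K, all (fun k : 'I_K => (r < k)%N) s ->
    forall O, O^T *m O = 1%:M -> unit_columns r O ->
    (forall k : 'I_K, (r < k)%N -> k \notin s -> O k q = 0) -> gaussian_stable O.
  refine (H [seq k : 'I_K <- ord_enum K | (r < k)%N] _ O OO uO _).
    exact: filter_all.
  by move=> k rk; rewrite mem_filter rk mem_ord_enum.
elim=> [_|j s IHs /= /andP[rj rs]] {}O {}OO {}uO zO.
  have qq k : k != q -> O k q = 0.
    move=> kq; have [rk|kr|rk] := ltngtP r k; first exact: zO.
    - by rewrite (@unit_columns_row r O OO uO k q kr) (negbTE kq).
    - by move: kq; rewrite -(inj_eq val_inj)/= -rk eqxx.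
  have O2 : O q q ^+ 2 = 1.
    have /matrixP/(_ q q) := OO; rewrite !mxE eqxx (bigD1 q)//= big1.
      by rewrite addr0 mxE expr2.
    by move=> k kq; rewrite qq// mulr0.
  have done1 O' : O'^T *m O' = 1%:M -> unit_columns r O' ->
      (forall k, k != q -> O' k q = 0) -> O' q q = 1 -> gaussian_stable O'.
    move=> OO' uO' qq' O1; apply: (IH r.+1) => //; first by rewrite addnS.
    move=> k l; rewrite ltnS leq_eqVlt => /orP[/eqP lr|]; last exact: uO'.
    have -> : l = q by exact/val_inj.
    by have [->|kq] := eqVneq k q; [rewrite O1|rewrite qq'].
  move/eqP: O2; rewrite sqrf_eq1 => /orP[/eqP O1|/eqP ON1]; first exact: done1.
  apply: (@gaussian_stable_flip q); apply: done1 => //.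
  - rewrite -OO; apply/matrixP => k l; rewrite !mxE; apply: eq_bigr => a _.
    by rewrite !mxE /flip_coord; case: eqP => [->|//]; rewrite mulrNN.
  - move=> k l lr; rewrite mxE /flip_coord (uO k)//; case: eqP => [->|//].
    rewrite uO// (_ : (q == l) = false) ?oppr0//.
    by apply/negbTE; rewrite -(inj_eq val_inj)/= neq_ltn lr orbT.
  - by move=> k kq; rewrite mxE /flip_coord (negbTE kq) qq.
  - by rewrite mxE /flip_coord eqxx ON1 opprK.
have [b0|b0] := eqVneq (O j q) 0.
  apply: IHs => // k rk ks; have [->//|kj] := eqVneq k j.
  by apply: zO => //; rewrite inE negb_or kj.
(* the rotation of the plane (q, j) that sends the entries (a, b) of column q
   to (rho, 0) *)
pose a := O q q; pose b := O j q; pose rho := Num.sqrt (a ^+ 2 + b ^+ 2).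
have ab0 : 0 < a ^+ 2 + b ^+ 2.
  by rewrite ltr_wpDl ?sqr_ge0// exprn_even_gt0.
have rho0 : rho != 0 by rewrite gt_eqF// sqrtr_gt0.
have rho2 : rho ^+ 2 = a ^+ 2 + b ^+ 2 by rewrite sqr_sqrtr// ltW.
pose c := a / rho; pose t := - b / rho.
have ct1 : c ^+ 2 + t ^+ 2 = 1.
  by rewrite /c /t !expr_div_n sqrrN -mulrDl -rho2 divff// sqrf_eq0.
have c1 : c != -1.
  apply/eqP => c1; move: ct1; rewrite c1 sqrrN expr1n => /eqP.
  rewrite -subr_eq0 addrAC subrr add0r sqrf_eq0 /t mulf_eq0 oppr_eq0.
  by rewrite invr_eq0 (negbTE b0) (negbTE rho0).
have qj : q != j by rewrite -(inj_eq val_inj)/= neq_ltn rj.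
have jq : j != q by rewrite eq_sym.
apply: (@gaussian_stable_rotmx q j c t) => //; apply: IHs => //.
- exact: rotmx_orthogonal.
- move=> k l lr; rewrite mxE /rotate_coords !uO//.
  have -> : (q == l) = false by apply/negbTE; rewrite -(inj_eq val_inj)/= neq_ltn lr orbT.
  have -> : (j == l) = false.
    by apply/negbTE; rewrite -(inj_eq val_inj)/= neq_ltn (ltn_trans lr rj) orbT.
  case: eqP => [->|_]; [|case: eqP => [->|//]].
  - by rewrite !mulr0 subr0 -(inj_eq val_inj)/= gtn_eqF.
  - by rewrite !mulr0 addr0 -(inj_eq val_inj)/= gtn_eqF// (ltn_trans lr rj).
- move=> k rk ks; rewrite mxE /rotate_coords.
  have -> : (k == q) = false by apply/negbTE; rewrite -(inj_eq val_inj)/= gtn_eqF.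
  case: eqP => [_|/eqP kj]; last by rewrite zO// inE negb_or kj.
  by rewrite -/a -/b /t /c; field.
Qed.

Lemma gaussian_family_orthogonal O X : O *m O^T = 1%:M -> gaussian_family X ->
  gaussian_family (fun i w => \sum_j O i j * X j w).
Proof.
move=> OO; apply: (@gaussian_stable_orthogonal K 0) => //; first by rewrite addn0.
exact: mulmx1C.
Qed.

End orthogonal_invariance.

Lemma gaussian_family_reindex (I I' : finType) (X : I -> T -> R) (f : I' -> I) :
  injective f -> gaussian_family X -> gaussian_family (fun i => X (f i)).
Proof.
move=> fI [mX iX lX]; split=> [i||i A mA]; [exact: mX| |exact: lX].
exact: (independent_reindex fI iX).
Qed.

Lemma gaussian_family_isometry (I : finType) (a : I -> I -> R) (X : I -> T -> R) :
  (forall i k, \sum_j a i j * a k j = (i == k)%:R) -> gaussian_family X ->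
  gaussian_family (fun i w => \sum_j a i j * X j w).
Proof.
move=> aa gX; pose O : 'M[R]_#|I| := \matrix_(k, l) a (enum_val k) (enum_val l).
have OO : O *m O^T = 1%:M.
  apply/matrixP => k l; rewrite !mxE.
  transitivity (\sum_j a (enum_val k) j * a (enum_val l) j).
    rewrite [RHS](reindex (@enum_val I I))/=; last exact/onW_bij/enum_val_bij.
    by apply: eq_bigr => j _; rewrite !mxE.
  by rewrite aa (inj_eq enum_val_inj).
have gX' := gaussian_family_reindex (@enum_val_inj I I) gX.
have := gaussian_family_reindex (@enum_rank_inj I)
  (gaussian_family_orthogonal OO gX').
congr gaussian_family; apply/funext => i; apply/funext => w.
rewrite [RHS](reindex (@enum_val I I))/=; last exact/onW_bij/enum_val_bij.
by apply: eq_bigr => j _; rewrite mxE enum_rankK.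
Qed.

End gaussian_families.

(** * Measurability of complex matrices *)

Section complex_measurability.
Variable R : realType.

Section complex_functions.
Context d (T : measurableType d).
Implicit Types f g : T -> R[i].

Definition measurable_cfun f :=
  measurable_fun setT (fun w => complex.Re (f w)) /\
  measurable_fun setT (fun w => complex.Im (f w)).

Lemma measurable_cfun_cst z : measurable_cfun (fun=> z).
Proof. by split; exact: measurable_cst. Qed.

Lemma measurable_cfunD f g : measurable_cfun f -> measurable_cfun g ->
  measurable_cfun (fun w => f w + g w).
Proof.
move=> [fr fi] [gr gi]; split.
  by under eq_fun do rewrite raddfD; exact: measurable_funD.
by under eq_fun do rewrite raddfD; exact: measurable_funD.
Qed.

Lemma measurable_cfunM f g : measurable_cfun f -> measurable_cfun g ->
  measurable_cfun (fun w => f w * g w).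
Proof.
move=> [fr fi] [gr gi]; split.
  rewrite (_ : (fun w => _) = (fun w => complex.Re (f w) * complex.Re (g w)
    - complex.Im (f w) * complex.Im (g w))); last first.
    by apply/funext => w; case: (f w); case: (g w).
  by apply: measurable_funB; exact: measurable_funM.
rewrite (_ : (fun w => _) = (fun w => complex.Re (f w) * complex.Im (g w)
  + complex.Im (f w) * complex.Re (g w))); last first.
  by apply/funext => w; case: (f w); case: (g w).
by apply: measurable_funD; exact: measurable_funM.
Qed.

Lemma measurable_cfun_conj f : measurable_cfun f ->
  measurable_cfun (fun w => (f w)^*).
Proof.
move=> [fr fi]; split.
  by rewrite (_ : (fun w => _) = (fun w => complex.Re (f w)))//;
    apply/funext => w; case: (f w).
rewrite (_ : (fun w => _) = (fun w => - complex.Im (f w))); last first.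
  by apply/funext => w; case: (f w).
exact: measurable_funN.
Qed.

Lemma measurable_cfun_sum (I : Type) (s : seq I) (f : I -> T -> R[i]) :
  (forall i, measurable_cfun (f i)) ->
  measurable_cfun (fun w => \sum_(i <- s) f i w).
Proof.
move=> mf; elim: s => [|i s IH].
  by under eq_fun do rewrite big_nil; exact: measurable_cfun_cst.
by under eq_fun do rewrite big_cons; exact: measurable_cfunD.
Qed.

End complex_functions.

Section matrix_functions.
Context d (T : measurableType d).

Lemma measurable_cmxP m n (X : T -> 'M[R[i]]_(m, n)) :
  measurable_fun setT (X : T -> cmx R m n) <->
  (forall i j, measurable_cfun (fun w => X w i j)).
Proof.
split=> [mX i j|mX].
  split=> _ B mB; rewrite setTI.
    have mA : measurable ([set M | B (complex.Re (M i j))] : set (cmx R m n)).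
      by apply: sub_sigma_algebra; exists i, j, B; split=> //; left.
    by have := mX measurableT _ mA; rewrite setTI.
  have mA : measurable ([set M | B (complex.Im (M i j))] : set (cmx R m n)).
    by apply: sub_sigma_algebra; exists i, j, B; split=> //; right.
  by have := mX measurableT _ mA; rewrite setTI.
apply: (@measurability _ _ T (cmx R m n) setT X (@mx_coord_sets R m n)); first by [].
move=> _ [_ [i [j [B [mB [->|->]]]]] <-]; have [mr mi] := mX i j.
  exact: mr.
exact: mi.
Qed.

Lemma measurable_adjmx m n (X : T -> 'M[R[i]]_(m, n)) :
  measurable_fun setT (X : T -> cmx R m n) ->
  measurable_fun setT ((fun w => (X w)^t*) : T -> cmx R n m).
Proof.
move=> /measurable_cmxP mX; apply/measurable_cmxP => i j.
by under eq_fun do rewrite !mxE; exact: measurable_cfun_conj.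
Qed.

Lemma measurable_mulmx m n p (X : T -> 'M[R[i]]_(m, n)) (Y : T -> 'M[R[i]]_(n, p)) :
  measurable_fun setT (X : T -> cmx R m n) ->
  measurable_fun setT (Y : T -> cmx R n p) ->
  measurable_fun setT ((fun w => X w *m Y w) : T -> cmx R m p).
Proof.
move=> /measurable_cmxP mX /measurable_cmxP mY; apply/measurable_cmxP => i j.
under eq_fun do rewrite mxE.
by apply: measurable_cfun_sum => k; exact: measurable_cfunM.
Qed.

Lemma measurable_addmx m n (X Y : T -> 'M[R[i]]_(m, n)) :
  measurable_fun setT (X : T -> cmx R m n) ->
  measurable_fun setT (Y : T -> cmx R m n) ->
  measurable_fun setT ((fun w => X w + Y w) : T -> cmx R m n).
Proof.
move=> /measurable_cmxP mX /measurable_cmxP mY; apply/measurable_cmxP => i j.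
by under eq_fun do rewrite mxE; exact: measurable_cfunD.
Qed.

Lemma measurable_scalemx m n (h : T -> R) (X : T -> 'M[R[i]]_(m, n)) :
  measurable_fun setT h -> measurable_fun setT (X : T -> cmx R m n) ->
  measurable_fun setT ((fun w => (h w)%:C *: X w) : T -> cmx R m n).
Proof.
move=> mh /measurable_cmxP mX; apply/measurable_cmxP => i j.
under eq_fun do rewrite mxE.
apply: measurable_cfunM => //.
Qed.

Lemma measurable_submx m n m' n' (f : 'I_m' -> 'I_m) (g : 'I_n' -> 'I_n)
    (X : T -> 'M[R[i]]_(m, n)) :
  measurable_fun setT (X : T -> cmx R m n) ->
  measurable_fun setT ((fun w => mxsub f g (X w)) : T -> cmx R m' n').
Proof.
move=> /measurable_cmxP mX; apply/measurable_cmxP => i j.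
by under eq_fun do rewrite mxE; exact: mX.
Qed.

Lemma measurable_block_mx m1 m2 n1 n2 (A : T -> 'M[R[i]]_(m1, n1))
    (B : T -> 'M[R[i]]_(m1, n2)) (C : T -> 'M[R[i]]_(m2, n1))
    (D : T -> 'M[R[i]]_(m2, n2)) :
  measurable_fun setT (A : T -> cmx R m1 n1) ->
  measurable_fun setT (B : T -> cmx R m1 n2) ->
  measurable_fun setT (C : T -> cmx R m2 n1) ->
  measurable_fun setT (D : T -> cmx R m2 n2) ->
  measurable_fun setT ((fun w => block_mx (A w) (B w) (C w) (D w)) :
    T -> cmx R (m1 + m2) (n1 + n2)).
Proof.
move=> /measurable_cmxP mA /measurable_cmxP mB /measurable_cmxP mC.
move=> /measurable_cmxP mD; apply/measurable_cmxP => i j.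
case: (split_ordP i) => a ->; case: (split_ordP j) => b ->.
- by under eq_fun do rewrite block_mxEul; exact: mA.
- by under eq_fun do rewrite block_mxEur; exact: mB.
- by under eq_fun do rewrite block_mxEdl; exact: mC.
- by under eq_fun do rewrite block_mxEdr; exact: mD.
Qed.

End matrix_functions.

Lemma measurable_cmx_eq d (T : measurableType d) m n
    (X Y : T -> 'M[R[i]]_(m, n)) :
  measurable_fun setT (X : T -> cmx R m n) ->
  measurable_fun setT (Y : T -> cmx R m n) ->
  measurable [set w | X w = Y w].
Proof.
move=> /measurable_cmxP mX /measurable_cmxP mY.
have -> : [set w | X w = Y w] = \bigcap_(ij in [set: 'I_m * 'I_n])
    [set w | X w ij.1 ij.2 = Y w ij.1 ij.2].
  apply/seteqP; split => [w XY [i j] _|w XY].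
    by rewrite /= (XY : X w = Y w).
  by apply/matrixP => i j; exact: (XY (i, j)).
apply: fin_bigcap_measurable; first exact: finite_finset.
move=> [i j] _ /=; have [mr mi] := mX i j; have [mr' mi'] := mY i j.
have -> : [set w | X w i j = Y w i j] =
    (fun w => (complex.Re (X w i j) == complex.Re (Y w i j)) &&
              (complex.Im (X w i j) == complex.Im (Y w i j))) @^-1` [set true].
  apply/seteqP; split=> w /=; first by move=> ->; rewrite !eqxx.
  by move=> H; apply/eqP; rewrite eq_complex.
rewrite -[X in measurable X]setTI; apply: measurable_and => //;
  exact: measurable_fun_eqr.
Qed.

End complex_measurability.

(** * Complex Gaussian matrices *)

Section complex_gaussian.
Variable R : realType.
Local Notation sigma := (Num.sqrt (2^-1 : R)).

Lemma sqrt_half_neq0 : sigma != 0.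
Proof. by rewrite gt_eqF// sqrtr_gt0 invr_gt0 ltr0n. Qed.

Definition mxcoord N g (M : 'M[R[i]]_(N, g)) (e : 'I_N * 'I_g * bool) : R :=
  if e.2 then complex.Re (M e.1.1 e.1.2) else complex.Im (M e.1.1 e.1.2).

Section one_space.
Context d (T : measurableType d) (P : probability T R).

Lemma complex_gaussian_mxE N g (G : T -> 'M[R[i]]_(N, g)) :
  complex_gaussian_mx P G = gaussian_family P sigma (fun e w => mxcoord (G w) e).
Proof. by []. Qed.

Lemma complex_gaussian_measurable N g (G : T -> 'M[R[i]]_(N, g)) :
  complex_gaussian_mx P G -> measurable_fun setT (G : T -> cmx R N g).
Proof.
move=> [mG _ _]; apply/measurable_cmxP => i j.
by split; [exact: (mG (i, j, true))|exact: (mG (i, j, false))].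
Qed.

Lemma complex_gaussian_submx N g N' g' (f : 'I_N' -> 'I_N) (h : 'I_g' -> 'I_g)
    (G : T -> 'M[R[i]]_(N, g)) : injective f -> injective h ->
  complex_gaussian_mx P G -> complex_gaussian_mx P (fun w => mxsub f h (G w)).
Proof.
move=> fI hI; rewrite !complex_gaussian_mxE => gG.
pose k (e : 'I_N' * 'I_g' * bool) := (f e.1.1, h e.1.2, e.2).
have kI : injective k.
  by move=> [[i j] b] [[i' j'] b'] [] /fI -> /hI -> ->.
have := gaussian_family_reindex kI gG; congr gaussian_family.
by apply/funext => -[[i j] b]; apply/funext => w; rewrite /mxcoord /= mxE.
Qed.

(** Conjugation changes the sign of the imaginary parts, which is an orthogonal
    map of the real coordinates. *)
Lemma complex_gaussian_adj N g (G : T -> 'M[R[i]]_(N, g)) :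
  complex_gaussian_mx P G -> complex_gaussian_mx P (fun w => (G w)^t*).
Proof.
rewrite !complex_gaussian_mxE => gG.
pose k (e : 'I_g * 'I_N * bool) := (e.1.2, e.1.1, e.2).
have kI : injective k by move=> [[i j] b] [[i' j'] b'] [] -> -> ->.
have gG' := gaussian_family_reindex kI gG.
pose a (e e' : 'I_g * 'I_N * bool) : R := (e == e')%:R * (-1) ^+ (~~ e.2).
have aE e (x : 'I_g * 'I_N * bool -> R) : \sum_e' a e e' * x e' = (-1) ^+ (~~ e.2) * x e.
  rewrite (bigD1 e)//= big1 => [|e']; first by rewrite /a eqxx mul1r addr0.
  by rewrite /a eq_sym => /negbTE ->; rewrite !mul0r.
have aa e e' : \sum_j a e j * a e' j = (e == e')%:R.
  rewrite aE /a eq_sym; have [->|_] := eqVneq; last by rewrite mul0r mulr0.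
  by rewrite mul1r -signr_addb addbb expr0.
have := gaussian_family_isometry sqrt_half_neq0 aa gG'; congr gaussian_family.
apply/funext => e; apply/funext => w; rewrite aE; case: e => -[i j] b /=.
rewrite /mxcoord /= !mxE; case: b => /=; case: (G w j i) => u v /=.
  by rewrite expr0 mul1r.
by rewrite expr1 mulN1r.
Qed.

(** A unitary factor acts on the real coordinates by an orthogonal matrix. *)
Lemma complex_gaussian_mulmxr N g (G : T -> 'M[R[i]]_(N, g)) (Q : 'M[R[i]]_g) :
  Q \is unitarymx ->
  complex_gaussian_mx P G -> complex_gaussian_mx P (fun w => G w *m Q).
Proof.
move=> uQ; rewrite !complex_gaussian_mxE => gG.
(* r z is the real 2 x 2 matrix of the multiplication by z *)
pose r (z : R[i]) (b c : bool) : R :=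
  if b == c then complex.Re z else if b then - complex.Im z else complex.Im z.
pose a (e e' : 'I_N * 'I_g * bool) : R :=
  (e.1.1 == e'.1.1)%:R * r (Q e'.1.2 e.1.2) e.2 e'.2.
have sumE (F : 'I_N * 'I_g * bool -> R) :
    \sum_e F e = \sum_i \sum_j (F (i, j, true) + F (i, j, false)).
  rewrite pair_bigA/=.
  transitivity (\sum_(ij : 'I_N * 'I_g) \sum_b F (ij, b)).
    by rewrite pair_bigA/=; apply: eq_bigr => -[].
  apply: eq_bigr => -[i j] _; rewrite (bigD1 true)//= (bigD1 false)//= big1 ?addr0//.
  by case.
have rr j j' b b' : \sum_k (r (Q k j) b true * r (Q k j') b' true +
    r (Q k j) b false * r (Q k j') b' false) = ((j == j') && (b == b'))%:R.
  have /matrixP/(_ j' j) := unitarymx_adj uQ.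
  rewrite !mxE => /eqP; rewrite eq_complex !raddf_sum/= => /andP[/eqP QR /eqP QI].
  have R1 : complex.Re ((j' == j)%:R : R[i]) = (j == j')%:R.
    by rewrite eq_sym; case: (j == j').
  have I0 : complex.Im ((j' == j)%:R : R[i]) = 0 by case: (j' == j).
  rewrite R1 in QR; rewrite I0 in QI.
  case: b; case: b'; rewrite /r /=.
  - rewrite andbT -QR.
    apply: eq_bigr => k _; rewrite !mxE.
    by case: (Q k j) => u v; case: (Q k j') => u' v' /=; ring.
  - rewrite andbF -[RHS]oppr0 -[in RHS]QI.
    rewrite -sumrN; apply: eq_bigr => k _; rewrite !mxE.
    by case: (Q k j) => u v; case: (Q k j') => u' v' /=; ring.
  - rewrite andbF -[RHS]QI.
    apply: eq_bigr => k _; rewrite !mxE.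
    by case: (Q k j) => u v; case: (Q k j') => u' v' /=; ring.
  - rewrite andbT -QR.
    apply: eq_bigr => k _; rewrite !mxE.
    by case: (Q k j) => u v; case: (Q k j') => u' v' /=; ring.
have aa e e' : \sum_j a e j * a e' j = (e == e')%:R.
  case: e e' => -[i j] b [[i' j'] b']; rewrite sumE /a /=.
  rewrite (bigD1 i)//= [X in _ + X]big1 ?addr0 => [|l li]; last first.
    by rewrite big1// => k _; rewrite [i == l]eq_sym (negbTE li) !mul0r addr0.
  rewrite eqxx !xpair_eqE.
  have [_|ii'] := eqVneq i i'.
    by rewrite /= -rr; apply: eq_bigr => k _; rewrite !mul1r.
  by rewrite big1// => k _; rewrite ?[i' == i]eq_sym ?(negbTE ii') !(mul0r, mulr0) addr0.
have := gaussian_family_isometry sqrt_half_neq0 aa gG; congr gaussian_family.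
apply/funext => -[[i j] b]; apply/funext => w; rewrite sumE /a /=.
rewrite (bigD1 i)//= [X in _ + X]big1 ?addr0 => [|l li]; last first.
  by rewrite big1// => k _; rewrite [i == l]eq_sym (negbTE li) !mul0r addr0.
rewrite eqxx /mxcoord /= mxE; case: b; rewrite raddf_sum /=; apply: eq_bigr => k _;
  rewrite /r /= !mul1r; case: (G w i k) => u v; case: (Q k j) => u' v' /=; ring.
Qed.

Lemma complex_gaussian_mulmxl N g (G : T -> 'M[R[i]]_(N, g)) (V : 'M[R[i]]_N) :
  V \is unitarymx ->
  complex_gaussian_mx P G -> complex_gaussian_mx P (fun w => V *m G w).
Proof.
move=> uV gG; have uV' : V^t* \is unitarymx by rewrite trmxC_unitary.
have := complex_gaussian_adj (complex_gaussian_mulmxr uV' (complex_gaussian_adj gG)).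
congr complex_gaussian_mx; apply/funext => w.
by rewrite adjmxM !trmxCK.
Qed.

Lemma complex_gaussian_cast N g N' g' (eN : N = N') (eg : g = g')
    (G : T -> 'M[R[i]]_(N, g)) :
  complex_gaussian_mx P G -> complex_gaussian_mx P (fun w => castmx (eN, eg) (G w)).
Proof.
case: _ / eN; case: _ / eg.
by congr complex_gaussian_mx; apply/funext => w; rewrite castmx_id.
Qed.

(** The blocks are functions of two disjoint groups of real coordinates. *)
Lemma complex_gaussian_independent N g N1 g1 N2 g2
    (f1 : 'I_N1 -> 'I_N) (h1 : 'I_g1 -> 'I_g)
    (f2 : 'I_N2 -> 'I_N) (h2 : 'I_g2 -> 'I_g) (G : T -> 'M[R[i]]_(N, g)) :
  (forall i j i' j', f1 i = f2 i' -> h1 j = h2 j' -> False) ->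
  complex_gaussian_mx P G ->
  independent2 P ((fun w => mxsub f1 h1 (G w)) : T -> cmx R N1 g1)
                 ((fun w => mxsub f2 h2 (G w)) : T -> cmx R N2 g2).
Proof.
move=> dis; rewrite complex_gaussian_mxE => -[mG iG _] A B mA mB.
pose J (N0 g0 : nat) (f : 'I_N0 -> 'I_N) (h : 'I_g0 -> 'I_g) :
  {set 'I_N * 'I_g * bool} :=
  [set e | (e.1.1 \in codom f) && (e.1.2 \in codom h)]%SET.
have sub N0 g0 (f : 'I_N0 -> 'I_N) (h : 'I_g0 -> 'I_g) (C : set (cmx R N0 g0)) :
    measurable C -> generated_by (fun e w => mxcoord (G w) e) (J N0 g0 f h)
      ((fun w => mxsub f h (G w)) @^-1` C).
  move=> mC; apply: generated_by_fun mC.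
  apply/(measurable_cmxP (T := g_sigma_algebraType _)) => i j.
  have inJ b : (f i, h j, b) \in J N0 g0 f h by rewrite inE /= !codom_f.
  have E b : (fun w => mxcoord (mxsub f h (G w)) (i, j, b)) =
      (fun w => mxcoord (G w) (f i, h j, b)).
    by apply/funext => w; rewrite /mxcoord /= mxE.
  have M b : measurable_fun setT ((fun w => mxcoord (mxsub f h (G w)) (i, j, b)) :
      g_sigma_algebraType (cylinders (fun e w => mxcoord (G w) e) (J N0 g0 f h)) -> R).
    rewrite E.
    exact: (measurable_generated_by (X := fun e w => mxcoord (G w) e) (inJ b)).
  by split; [exact: (M true)|exact: (M false)].
apply: (independent_groups mG iG _ (sub _ _ f1 h1 A mA) (sub _ _ f2 h2 B mB)).
apply/pred0P => -[[i j] b] /=; apply/negP => /andP[]; rewrite !inE /=.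
move=> /andP[/codomP[i1 ->] /codomP[j1 ->]] /andP[/codomP[i2 ii] /codomP[j2 jj]].
exact: dis ii jj.
Qed.

End one_space.

Definition mxboxes N g : set (set (cmx R N g)) :=
  [set A | exists B : 'I_N * 'I_g * bool -> set R, (forall e, measurable (B e)) /\
     A = [set M | forall e, B e (mxcoord M e)]].

Lemma mxboxesI N g : setI_closed (@mxboxes N g).
Proof.
move=> _ _ [A [mA ->]] [B [mB ->]]; exists (fun e => A e `&` B e).
split; first by move=> e; exact: measurableI.
apply/seteqP; split => [M [AM BM] e|M ABM]; first by split.
by split=> e; have [] := ABM e.
Qed.

Lemma mxboxes_measurable N g : @mxboxes N g `<=` measurable.
Proof.
move=> _ [B [mB ->]].
rewrite (_ : mkset _ = \bigcap_(e in [set: 'I_N * 'I_g * bool])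
  [set M | B e (mxcoord M e)]); last first.
  by apply/seteqP; split => [M BM e _|M BM e]; [exact: BM|exact: BM].
apply: fin_bigcap_measurable; first exact: finite_finset.
move=> [[i j] b] _; apply: sub_sigma_algebra; exists i, j, (B (i, j, b)).
by split=> //; case: b; [left|right].
Qed.

Lemma measurable_mxboxes N g : (measurable : set (set (cmx R N g))) `<=` <<s @mxboxes N g >>.
Proof.
apply: smallest_sub; first exact: smallest_sigma_algebra.
have H i j b (B : set R) : measurable B ->
    <<s @mxboxes N g >> [set M : cmx R N g | B (mxcoord M (i, j, b))].
  move=> mB; apply: sub_gen_smallest.
  exists (fun e => if e == (i, j, b) then B else setT); split.
    by move=> e; case: ifP.
  apply/seteqP; split=> [M BM e|M /(_ (i, j, b))]; last by rewrite eqxx.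
  by case: eqP => [->|].
by move=> _ [i [j [B [mB [->|->]]]]]; [exact: (H i j true)|exact: (H i j false)].
Qed.

(** Both laws give a box the product of the normal measures of its sides, and
    the boxes form a pi-system that generates the sigma-algebra. *)
Lemma complex_gaussian_law d (T : measurableType d) (P : probability T R)
    d' (T' : measurableType d') (P' : probability T' R) N g
    (G : T -> 'M[R[i]]_(N, g)) (G' : T' -> 'M[R[i]]_(N, g)) :
  complex_gaussian_mx P G -> complex_gaussian_mx P' G' ->
  forall A : set (cmx R N g), measurable A -> P (G @^-1` A) = P' (G' @^-1` A).
Proof.
move=> gG gG' A mA.
have mG := complex_gaussian_measurable gG.
have mG' := complex_gaussian_measurable gG'.
pose X : {mfun T >-> cmx R N g} :=
  HB.pack (G : T -> cmx R N g) (isMeasurableFun.Build _ _ _ _ _ mG).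
pose X' : {mfun T' >-> cmx R N g} :=
  HB.pack (G' : T' -> cmx R N g) (isMeasurableFun.Build _ _ _ _ _ mG').
suff : distribution P X A = distribution P' X' A by [].
apply: (@g_sigma_algebra_measure_unique _ R (cmx R N g) (@mxboxes N g)
  (@mxboxes_measurable N g) (fun=> setT)).
- move=> _; exists (fun=> setT); split=> //.
  by apply/seteqP; split.
- by rewrite bigcup_const//; exists 0%N.
- exact: mxboxesI.
- move=> _ [B [mB ->]].
  have box d0 (T0 : measurableType d0) (P0 : probability T0 R)
      (G0 : T0 -> 'M[R[i]]_(N, g)) : complex_gaussian_mx P0 G0 ->
      P0 (G0 @^-1` [set M | forall e, B e (mxcoord M e)]) =
      (\prod_e normal_prob 0 sigma (B e))%E.
    rewrite complex_gaussian_mxE => g0; have [m0 _ _] := g0.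
    rewrite -((gaussian_boxP P0 sigma m0).1 g0 B mB); congr (P0 _).
    by apply/seteqP; split => w Bw e; [move=> _|]; exact: Bw.
  exact: etrans (box _ _ _ _ gG) (esym (box _ _ _ _ gG')).
- by move=> k; rewrite -ge0_fin_numE ?measure_ge0// fin_num_measure.
- exact: measurable_mxboxes.
Qed.

End complex_gaussian.

(** * Functional calculus of Hermitian matrices *)

Section functional_calculus.
Variables (R : realType) (N : nat).
Implicit Types (X V : 'M[R[i]]_N) (f g : R -> R).

Lemma hermsymmxP X : reflect (X^t* = X) (X \is hermsymmx).
Proof.
apply: (iffP (is_hermitianmxP _ _ _)); rewrite expr0 scale1r; exact: esym.
Qed.

Definition eigenval X (a : 'I_N) : R := complex.Re (spectral_diag X 0 a).

Definition real_diag (x : 'I_N -> R) : 'M[R[i]]_N := diag_mx (\row_a (x a)%:C).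

(** The usual f (X) for a Hermitian matrix X; the value 0 on other matrices is a
    convention. *)
Definition fcalc f X : 'M[R[i]]_N :=
  if X \is hermsymmx then
    (spectralmx X)^t* *m real_diag (f \o eigenval X) *m spectralmx X
  else 0.

Lemma real_diagM x y : real_diag x *m real_diag y = real_diag (fun a => x a * y a).
Proof.
rewrite /real_diag mulmx_diag; congr diag_mx; apply/rowP => a.
by rewrite !mxE rmorphM.
Qed.

Lemma real_diag_adj x : (real_diag x)^t* = real_diag x.
Proof.
rewrite /real_diag tr_diag_mx map_diag_mx; congr diag_mx; apply/rowP => a.
by rewrite !mxE; apply: conj_Creal; rewrite complex_real.
Qed.

Lemma hermsymmx_spectral X : X \is hermsymmx ->
  X = (spectralmx X)^t* *m real_diag (eigenval X) *m spectralmx X.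
Proof.
move=> hX; rewrite [LHS](hermsymmx_spectralE hX).
suff -> : diag_mx (spectral_diag X) = real_diag (eigenval X) by [].
rewrite /real_diag; congr diag_mx; apply/rowP => a; rewrite [RHS]mxE /eigenval.
by have /mxOverP/(_ 0 a) := hermitian_spectral_diag_real hX; move=> /RRe_real.
Qed.

Lemma hermsymmx_conj V x :
  V^t* *m real_diag x *m V \is hermsymmx.
Proof. by apply/hermsymmxP; rewrite !adjmxM trmxCK real_diag_adj mulmxA. Qed.

(** The unitary matrix W that relates two diagonalisations e and x of X satisfies
    diag e W = W diag x. Entrywise, W i j vanishes unless e i = x j, hence
    diag (f e) W = W diag (f x), and any diagonalisation computes f (X). *)
Lemma fcalcE f X V x : V \is unitarymx ->
  X = V^t* *m real_diag x *m V -> fcalc f X = V^t* *m real_diag (f \o x) *m V.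
Proof.
move=> uV XV; have hX : X \is hermsymmx by rewrite XV hermsymmx_conj.
rewrite /fcalc hX; set U := spectralmx X; set e := eigenval X.
have uU : U \is unitarymx := spectral_unitarymx X.
have XU : X = U^t* *m real_diag e *m U := hermsymmx_spectral hX.
clearbody U e.
pose W := U *m V^t*.
have UW : U^t* *m W = V^t* by rewrite /W mulmxA (unitarymx_adj uU) mul1mx.
have WV : W *m V = U by rewrite /W -mulmxA (unitarymx_adj uV) mulmx1.
have UX : real_diag e *m U = U *m X.
  by rewrite [in RHS]XU !mulmxA (unitarymxP uU) mul1mx.
have XVx : X *m V^t* = V^t* *m real_diag x.
  by rewrite XV -!mulmxA (unitarymxP uV) mulmx1.
have eW : real_diag e *m W = W *m real_diag x.
  by rewrite /W mulmxA UX -(mulmxA U X) XVx mulmxA.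
clearbody W.
have feW : real_diag (f \o e) *m W = W *m real_diag (f \o x).
  apply/matrixP => i j; have /matrixP/(_ i j) := eW.
  rewrite /real_diag !mul_diag_mx !mul_mx_diag !mxE [_ * W i j]mulrC => /eqP.
  rewrite -subr_eq0 -mulrBr mulf_eq0 => /orP[/eqP ->|]; first by rewrite mulr0 mul0r.
  rewrite subr_eq0 => /eqP [] ex; rewrite mulrC /=; congr (_ * (f _)%:C).
  exact: ex.
by rewrite -[X in _ *m X = _]WV mulmxA -(mulmxA (U^t*)) feW mulmxA UW.
Qed.

Section hermitian.
Variable X : 'M[R[i]]_N.
Hypothesis hX : X \is hermsymmx.

Let U := spectralmx X.
Let uU : U \is unitarymx. Proof. exact: spectral_unitarymx. Qed.

Lemma fcalc_hermE f : fcalc f X = U^t* *m real_diag (f \o eigenval X) *m U.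
Proof. by rewrite /fcalc hX. Qed.

Lemma fcalc_id : fcalc id X = X.
Proof. by rewrite fcalc_hermE; exact: esym (hermsymmx_spectral hX). Qed.

Lemma fcalc_cst c : fcalc (fun=> c) X = c%:C%:M.
Proof.
rewrite fcalc_hermE (_ : real_diag _ = c%:C%:M).
  by rewrite mul_mx_scalar -scalemxAl unitarymx_adj// scalemx1.
by apply/matrixP => a b; rewrite !mxE.
Qed.

Lemma fcalcM f g : fcalc (fun x => f x * g x) X = fcalc f X *m fcalc g X.
Proof.
by rewrite !fcalc_hermE (unitary_conjM _ _ uU) real_diagM.
Qed.

Lemma fcalcD f g : fcalc (fun x => f x + g x) X = fcalc f X + fcalc g X.
Proof.
rewrite !fcalc_hermE -mulmxDl -mulmxDr; congr (_ *m _ *m _).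
apply/matrixP => a b; rewrite !mxE -mulrnDl; congr (_ *+ _).
by rewrite rmorphD.
Qed.

Lemma fcalc_hermsymmx f : fcalc f X \is hermsymmx.
Proof. by rewrite fcalc_hermE hermsymmx_conj. Qed.

Lemma fcalc_comp f g : fcalc (f \o g) X = fcalc f (fcalc g X).
Proof. by rewrite [RHS](fcalcE _ uU (fcalc_hermE g)) fcalc_hermE. Qed.

Lemma fcalc_entry f i j : fcalc f X i j =
  \sum_a (f (eigenval X a))%:C * ((U a i)^* * U a j).
Proof.
rewrite fcalc_hermE /real_diag mxE; apply: eq_bigr => a _.
by rewrite mul_mx_diag !mxE /= mulrAC mulrC.
Qed.

End hermitian.

Lemma fcalc_nherm f X : X \isn't hermsymmx -> fcalc f X = 0.
Proof. by rewrite /fcalc => /negbTE ->. Qed.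

End functional_calculus.

(** * Measurability of the functional calculus *)

Section measurable_calculus.
Variables (R : realType) (N : nat).
Implicit Types (X : 'M[R[i]]_N) (f g : R -> R).

(** Eigenvectors are not chosen measurably, so the measurability of X |-> f (X)
    is established through the closure properties of the class of functions f
    for which it holds. *)
Definition calc_measurable f :=
  measurable_fun setT (fcalc f : cmx R N N -> cmx R N N).

Lemma measurable_hermsymmx :
  measurable ([set X | X \is hermsymmx] : set (cmx R N N)).
Proof.
rewrite (_ : mkset _ = [set X : 'M[R[i]]_N | X^t* = X]); last first.
  by apply/seteqP; split=> X /hermsymmxP.
by apply: measurable_cmx_eq; [apply: measurable_adjmx|]; exact: measurable_id.
Qed.

Lemma calc_measurable_on_herm f (F : 'M[R[i]]_N -> 'M[R[i]]_N) :
  measurable_fun setT (F : cmx R N N -> cmx R N N) ->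
  (forall X, X \is hermsymmx -> fcalc f X = F X) -> calc_measurable f.
Proof.
move=> mF fF.
rewrite /calc_measurable.
have -> : fcalc f = fun X => (\1_[set X | X \is hermsymmx] X)%:C *: F X.
  apply/funext => X; rewrite indicE; have [hX|hX] := boolP (X \is hermsymmx).
    by rewrite mem_set// scale1r fF.
  by rewrite memNset ?scale0r ?fcalc_nherm//; exact/negP.
apply: (measurable_scalemx (T := cmx R N N)) => //.
by apply: measurable_indic; exact: measurable_hermsymmx.
Qed.

Lemma calc_measurable_id : calc_measurable id.
Proof.
apply: (@calc_measurable_on_herm _ id) => [|X]; first exact: measurable_id.
exact: fcalc_id.
Qed.

Lemma calc_measurable_cst c : calc_measurable (fun=> c).
Proof.
apply: (@calc_measurable_on_herm _ (fun=> c%:C%:M)) => [|X].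
  exact: measurable_cst.
by move=> hX; rewrite fcalc_cst.
Qed.

Lemma calc_measurableD f g : calc_measurable f -> calc_measurable g ->
  calc_measurable (fun x => f x + g x).
Proof.
move=> mf mg; apply: calc_measurable_on_herm (measurable_addmx mf mg) _ => X hX.
by rewrite fcalcD.
Qed.

Lemma calc_measurableM f g : calc_measurable f -> calc_measurable g ->
  calc_measurable (fun x => f x * g x).
Proof.
move=> mf mg; apply: calc_measurable_on_herm (measurable_mulmx mf mg) _ => X hX.
by rewrite fcalcM.
Qed.

Lemma calc_measurable_comp f g : calc_measurable f -> calc_measurable g ->
  calc_measurable (f \o g).
Proof.
move=> mf mg; apply: calc_measurable_on_herm (measurableT_comp mf mg) _ => X hX.
by rewrite fcalc_comp.
Qed.

Lemma calc_measurableX f k : calc_measurable f ->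
  calc_measurable (fun x => f x ^+ k).
Proof.
move=> mf; elim: k => [|k IH].
  by under eq_fun do rewrite expr0; exact: calc_measurable_cst.
by under eq_fun do rewrite exprS; exact: calc_measurableM.
Qed.

Lemma calc_measurableZ c f : calc_measurable f ->
  calc_measurable (fun x => c * f x).
Proof. by apply: calc_measurableM; exact: calc_measurable_cst. Qed.

Lemma calc_measurable_sum (I : Type) (s : seq I) (f : I -> R -> R) :
  (forall i, calc_measurable (f i)) ->
  calc_measurable (fun x => \sum_(i <- s) f i x).
Proof.
move=> mf; elim: s => [|i s IH].
  by under eq_fun do rewrite big_nil; exact: calc_measurable_cst.
rewrite (_ : (fun x => _) = fun x => f i x + \sum_(j <- s) f j x); last first.
  by apply/funext => x; rewrite big_cons.
exact: (calc_measurableD (mf i) IH).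
Qed.

Let cvg_wsum (I : Type) (s : seq I) (u : I -> R^nat) (l w : I -> R) :
  (forall i, u i n @[n --> \oo] --> l i) ->
  \sum_(i <- s) u i n * w i @[n --> \oo] --> \sum_(i <- s) l i * w i.
Proof.
move=> ul; elim: s => [|i s IH].
  by under eq_fun do rewrite big_nil; rewrite big_nil; exact: cvg_cst.
under eq_fun do rewrite big_cons; rewrite big_cons; apply: cvgD => //.
by apply: cvgM => //; exact: cvg_cst.
Qed.

(** The entries of f (X) are finite sums of values of f at the eigenvalues,
    hence pointwise convergence is inherited. *)
Lemma calc_measurable_cvg (h : (R -> R)^nat) f :
  (forall n, calc_measurable (h n)) ->
  (forall x, h n x @[n --> \oo] --> f x) -> calc_measurable f.
Proof.
move=> mh hf; apply/(measurable_cmxP (T := cmx R N N)) => i j.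
have mhn n := (measurable_cmxP (T := cmx R N N) (fcalc (h n))).1 (mh n) i j.
have RM (a : R) (z : R[i]) : complex.Re (a%:C * z) = a * complex.Re z.
  by case: z => u v /=; rewrite mul0r subr0.
have IM (a : R) (z : R[i]) : complex.Im (a%:C * z) = a * complex.Im z.
  by case: z => u v /=; rewrite mul0r addr0.
have ReE g X : X \is hermsymmx -> complex.Re (fcalc g X i j) =
    \sum_a g (eigenval X a) *
      complex.Re ((spectralmx X a i)^* * spectralmx X a j).
  move=> hX; rewrite fcalc_entry// raddf_sum; apply: eq_bigr => a _.
  exact: RM.
have ImE g X : X \is hermsymmx -> complex.Im (fcalc g X i j) =
    \sum_a g (eigenval X a) *
      complex.Im ((spectralmx X a i)^* * spectralmx X a j).
  move=> hX; rewrite fcalc_entry// raddf_sum; apply: eq_bigr => a _.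
  exact: IM.
split.
  apply: (@measurable_fun_cvg _ (cmx R N N) R setT
    (fun n X => complex.Re (fcalc (h n) X i j))) => [n|X _]; first exact: (mhn n).1.
  have [hX|hX] := boolP (X \is hermsymmx); last first.
    by under eq_fun do rewrite fcalc_nherm//; rewrite fcalc_nherm//; exact: cvg_cst.
  have E : (fun n => complex.Re (fcalc (h n) X i j)) = (fun n =>
    \sum_a h n (eigenval X a) * complex.Re ((spectralmx X a i)^* * spectralmx X a j)).
    by apply/funext => n; exact: (ReE (h n) X hX).
  rewrite E (ReE f X hX).
  by apply: cvg_wsum => a; exact: hf.
apply: (@measurable_fun_cvg _ (cmx R N N) R setT
  (fun n X => complex.Im (fcalc (h n) X i j))) => [n|X _]; first exact: (mhn n).2.
have [hX|hX] := boolP (X \is hermsymmx); last first.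
  by under eq_fun do rewrite fcalc_nherm//; rewrite fcalc_nherm//; exact: cvg_cst.
have E : (fun n => complex.Im (fcalc (h n) X i j)) = (fun n =>
    \sum_a h n (eigenval X a) * complex.Im ((spectralmx X a i)^* * spectralmx X a j)).
  by apply/funext => n; exact: (ImE (h n) X hX).
rewrite E (ImE f X hX).
by apply: cvg_wsum => a; exact: hf.
Qed.

Lemma calc_measurable_expR : calc_measurable (@expR R).
Proof.
apply: (@calc_measurable_cvg (fun n x => \sum_(0 <= k < n) k`!%:R^-1 * x ^+ k)).
  move=> n; apply: calc_measurable_sum => k; apply: calc_measurableZ.
  by apply: calc_measurableX; exact: calc_measurable_id.
move=> x; rewrite (_ : (fun n => _) = series (exp_coeff x)).
  exact: is_cvg_series_exp_coeff.
by apply/funext => n; rewrite exp_coeffE.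
Qed.

(** The limit of exp (- exp (- x) ^+ n). Its value at 0 lies strictly between 0
    and 1, hence the powers of step converge to the indicator of the positive
    half-line. *)
Let step (x : R) : R := if 0 < x then 1 else if x == 0 then expR (- 1) else 0.

Let step_measurable : calc_measurable step.
Proof.
apply: (@calc_measurable_cvg (fun n x => expR (- 1 * expR (- 1 * x) ^+ n))).
  move=> n; apply: (calc_measurable_comp calc_measurable_expR).
  apply: calc_measurableZ; apply: calc_measurableX.
  apply: (calc_measurable_comp calc_measurable_expR).
  by apply: calc_measurableZ; exact: calc_measurable_id.
move=> x; rewrite /step; have [x0|x0|<-] := ltgtP 0 x.
- have e0 : expR (- 1 * x) ^+ n @[n --> \oo] --> 0.
    by apply: cvg_expr; rewrite ger0_norm ?expR_ge0// expR_lt1 mulN1r oppr_lt0.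
  have c0 : expR (- 1 * y) @[y --> (0 : R)] --> expR (- 1 * 0 : R).
    apply: continuous_comp; last exact: continuous_expR.
    by apply: cvgM; [exact: cvg_cst|exact: cvg_id].
  have := cvg_comp _ _ e0 c0.
  by rewrite (_ : expR (- 1 * 0) = 1 :> R)// mulr0 expR0.
- apply: (@squeeze_cvgr _ _ _ _ (cst 0) (fun n => expR x ^+ n)).
  + near=> n; rewrite expR_ge0/= !mulN1r !expRN.
    rewrite -[leRHS]invrK lef_pV2 ?posrE ?expR_gt0 ?invr_gt0 ?exprn_gt0 ?expR_gt0//.
    by rewrite (le_trans _ (expR_ge1Dx _))// exprVn lerDr.
  + exact: cvg_cst.
  + by apply: cvg_expr; rewrite ger0_norm ?expR_ge0// expR_lt1.
- under eq_fun do rewrite mulr0 expR0 expr1n mulr1; exact: cvg_cst.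
Unshelve. all: by end_near. Qed.

Let calc_measurable_ray (a : R) : calc_measurable (\1_(`]a, +oo[)).
Proof.
have ms : calc_measurable (fun x => step (x - a)).
  apply: (calc_measurable_comp step_measurable).
  by apply: calc_measurableD; [exact: calc_measurable_id|exact: calc_measurable_cst].
apply: (@calc_measurable_cvg (fun n x => step (x - a) ^+ n.+1)).
  by move=> n; exact: calc_measurableX.
move=> x; rewrite indicE (_ : (x \in _) = (a < x)); last first.
  by apply/idP/idP; rewrite inE /= in_itv/= andbT.
rewrite /step subr_gt0 subr_eq0.
have [ax|xa|_] := ltgtP a x.
- by under eq_fun do rewrite expr1n; exact: cvg_cst.
- by under eq_fun do rewrite expr0n; exact: cvg_cst.
- rewrite cvg_shiftS; apply: cvg_expr.
  by rewrite ger0_norm ?expR_ge0// expR_lt1 oppr_lt0.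
Qed.

(** The sets whose indicator belongs to the class form a lambda-system that
    contains the open rays. *)
Lemma calc_measurable_indic (B : set R) : measurable B -> calc_measurable (\1_B).
Proof.
pose G : set (set R) := [set A | exists a, A = `]a, +oo[%classic].
have -> : (measurable : set (set R)) = <<s G >>.
  by rewrite -[LHS]/(@measurable _ (measurableTypeR R)) RGenOInfty.measurableE.
move: B; apply: lambda_system_subset.
- move=> _ _ [a ->] [b ->]; exists (Num.max a b).
  by apply/seteqP; split=> x /=; rewrite !in_itv/= !andbT gt_max => /andP.
- split.
  + by move=> A _; exact: subsetT.
  + by rewrite /= indicT; exact: calc_measurable_cst.
  + move=> A B BA mA mB; rewrite /=.
    rewrite (_ : \1_(A `\` B) = fun x => \1_A x + -1 * \1_B x).
      exact: (calc_measurableD mA (calc_measurableZ (-1) mB)).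
    apply/funext => x; rewrite !indicE in_setD mulN1r.
    have [xB|xB] := boolP (x \in B); last by rewrite andbT subr0.
    rewrite (_ : x \in A); last by rewrite inE; apply: BA; rewrite inE in xB.
    by rewrite subrr.
  + move=> F ndF mF; apply: (@calc_measurable_cvg (fun n => \1_(F n))) => [|x]; first exact: mF.
    rewrite !indicE.
    have [xF|xF] := boolP (x \in \bigcup_n F n).
      move: xF; rewrite inE => -[n _ Fnx]; apply: cvg_near_cst; near=> k.
      have nk : (n <= k)%N by near: k; exists n.
      have Fkx : F k x by have /subsetPset := ndF _ _ nk; apply.
      by rewrite indicE !mem_set//; exists n.
    apply: cvg_near_cst; apply: nearW => n; rewrite indicE.
    by rewrite memNset// => Fx; move/negP: xF; apply; rewrite inE; exists n.
- by move=> _ [a ->]; exact: calc_measurable_ray.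
- by [].
Unshelve. all: by end_near. Qed.

Import HBNNSimple.

(** Approximation by simple functions. *)
Lemma calc_measurable_borel f : measurable_fun setT f -> (forall x, 0 <= f x) ->
  calc_measurable f.
Proof.
move=> mf f0.
have mf' : measurable_fun setT (EFin \o f) by exact/measurable_EFinP.
pose g n := nnsfun_approx measurableT mf' n.
have mg n : calc_measurable (g n).
  have -> : (g n : R -> R) = fun x => _ := funext (fimfunEord (g n)).
  apply: calc_measurable_sum => k; apply: calc_measurableZ.
  by apply: calc_measurable_indic; rewrite -[X in measurable X]setTI; exact: measurable_funP.
have cg x : g n x @[n --> \oo] --> f x.
  have := cvg_nnsfun_approx measurableT mf' (fun x _ => f0 x : (0 <= (EFin \o f) x)%E)
    (Logic.I : [set: R] x).
  by move=> /fine_cvgP[].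
exact: calc_measurable_cvg mg cg.
Qed.

End measurable_calculus.

(** * Positive square roots *)

Section positive_matrices.
Variables (R : realType) (N : nat).
Implicit Types A X : 'M[R[i]]_N.

Lemma gram_psd n (G : 'M[R[i]]_(N, n)) : psdmx (G *m G^t*).
Proof.
split; first by apply/hermsymmxP; rewrite adjmxM trmxCK.
move=> v; have -> : v^t* *m (G *m G^t*) *m v = (v^t* *m G) *m (v^t* *m G)^t*.
  by rewrite adjmxM trmxCK !mulmxA.
move: (v^t* *m G) => w; rewrite mxE; apply: sumr_ge0 => k _.
by rewrite !mxE mul_conjC_ge0.
Qed.

Lemma eigenval_form X a : X \is hermsymmx ->
  (row a (spectralmx X) *m X *m (row a (spectralmx X))^t*) 0 0 =
  (eigenval X a)%:C.
Proof.
move=> hX; have /unitarymxP UU := spectral_unitarymx X.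
rewrite {2}(hermsymmx_spectral hX).
have -> M : (row a (spectralmx X) *m M *m (row a (spectralmx X))^t*) 0 0 =
    (spectralmx X *m M *m (spectralmx X)^t*) a a.
  rewrite -row_mul [LHS]mxE [RHS]mxE; apply: eq_bigr => k _.
  by congr (_ * _); [rewrite mxE|rewrite !mxE].
rewrite !mulmxA UU mul1mx -mulmxA UU mulmx1 /real_diag !mxE eqxx.
by [].
Qed.

Lemma psdmx_eigenval_ge0 A a : psdmx A -> 0 <= eigenval A a.
Proof.
move=> [hA /(_ ((row a (spectralmx A))^t*))].
by rewrite trmxCK eigenval_form// lecR.
Qed.

(** This is what makes a nonnegative matrix measure vanish on the measurable
    subsets of its null sets. *)
Lemma psdmx_addr0 A B : psdmx A -> psdmx B -> A + B = 0 -> A = 0.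
Proof.
move=> pA pB AB; have [hA _] := pA.
rewrite [A](hermsymmx_spectral hA).
suff -> : real_diag (eigenval A) = 0 by rewrite mulmx0 mul0mx.
apply/matrixP => a b; rewrite !mxE; suff -> : eigenval A a = 0 by rewrite mul0rn.
apply/eqP; rewrite eq_le psdmx_eigenval_ge0// andbT.
rewrite -lecR -eigenval_form//.
have [_ /(_ ((row a (spectralmx A))^t*))] := pB.
rewrite trmxCK (_ : B = - A) ?mulmxN ?mulNmx ?mxE ?oppr_ge0//.
by apply/eqP; rewrite -addr_eq0 addrC AB.
Qed.

Definition msqrt A := fcalc Num.sqrt A.

Lemma measurable_msqrt : measurable_fun setT (msqrt : cmx R N N -> cmx R N N).
Proof.
apply: calc_measurable_borel => [|x]; last exact: sqrtr_ge0.
by apply: continuous_measurable_fun; exact: sqrt_continuous.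
Qed.

Lemma msqrt_sqr A : psdmx A -> msqrt (A *m A) = A.
Proof.
move=> pA; have [hA _] := pA.
pose U := spectralmx A; have uU : U \is unitarymx := spectral_unitarymx A.
have AE := hermsymmx_spectral hA.
have A2 : A *m A = U^t* *m real_diag (fun a => eigenval A a * eigenval A a) *m U.
  by rewrite {1 2}AE (unitary_conjM _ _ uU) real_diagM.
rewrite /msqrt (fcalcE _ uU A2) [RHS]AE.
suff -> : real_diag (Num.sqrt \o (fun a => eigenval A a * eigenval A a)) =
    real_diag (eigenval A) by [].
congr real_diag; apply/funext => a /=.
by rewrite -expr2 sqrtr_sqr ger0_norm// psdmx_eigenval_ge0.
Qed.

Lemma sqr_msqrt A : psdmx A -> msqrt A *m msqrt A = A.
Proof.
move=> pA; have [hA _] := pA.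
pose U := spectralmx A; have uU : U \is unitarymx := spectral_unitarymx A.
rewrite /msqrt fcalc_hermE// (unitary_conjM _ _ uU) real_diagM.
rewrite [RHS](hermsymmx_spectral hA) -/U.
suff -> : real_diag (fun a => (Num.sqrt \o eigenval A) a * (Num.sqrt \o eigenval A) a) =
    real_diag (eigenval A) by [].
congr real_diag; apply/funext => a /=.
by rewrite -expr2 sqr_sqrtr// psdmx_eigenval_ge0.
Qed.

Lemma msqrt_adj A : psdmx A -> (msqrt A)^t* = msqrt A.
Proof. by move=> [hA _]; apply/hermsymmxP; exact: fcalc_hermsymmx. Qed.

End positive_matrices.

(** * Spectral matrix measures through the functional calculus *)

Section interpolation.
Variable R : realType.

Lemma interpolation (t : seq R) (f : R -> R) : uniq t ->
  exists q : {poly R}, {in t, forall x, q.[x] = f x}.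
Proof.
elim: t => [_|y t IH /= /andP[yt /IH[q qf]]]; first by exists 0.
pose r := \prod_(z <- t) ('X - z%:P).
have ry : r.[y] != 0 by rewrite -rootE root_prod_XsubC.
exists (q + ((f y - q.[y]) / r.[y])%:P * r) => x.
rewrite inE hornerD hornerCM => /orP[/eqP ->|xt].
  by rewrite divfK// addrC subrK.
have /eqP -> : root r x by rewrite root_prod_XsubC.
by rewrite mulr0 addr0 qf.
Qed.

Lemma charge_finite_support (nu : {charge set R -> \bar R}) (t : seq R) :
  uniq t ->
  (forall B, measurable B -> (forall x, x \in t -> ~ B x) -> nu B = 0%E) ->
  forall B, measurable B ->
    nu B = (\sum_(e <- [seq (fine (nu [set x]), x) | x <- t]) e.1 * \1_B e.2)%:E.
Proof.
elim: t nu => [nu _ nu0 B mB|y t IH nu /= /andP[yt ut] nu0 B mB].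
  by rewrite big_nil nu0.
have m1 (x : R) : measurable ([set x] : set R) by exact: measurable_set1.
have fy : nu [set y] = (fine (nu [set y]))%:E by rewrite fineK// fin_num_measure.
pose nu' : {charge set R -> \bar R} := cadd nu
  (cscale (- fine (nu [set y])) (charge_of_finite_measure (@dirac _ R y R))).
have nu'E A : nu' A = (nu A + (- fine (nu [set y]) * \1_A y)%:E)%E by [].
have := IH nu' ut; rewrite big_cons /= => H.
have {}H : nu' B = (\sum_(e <- [seq (fine (nu' [set x]), x) | x <- t]) e.1 * \1_B e.2)%:E.
  apply: H => // A mA At; rewrite nu'E.
  have [yA|yA] := boolP (y \in A); last first.
    rewrite indicE (negbTE yA) mulr0 adde0; apply: nu0 => // x.
    rewrite inE => /orP[/eqP -> yA'|/At//]; move/negP: yA; apply.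
    by rewrite inE.
  have -> : nu A = (nu [set y] + nu (A `\ y))%E.
    rewrite -chargeU//; last 2 first.
    - exact: measurableD.
    - by apply/seteqP; split => [z /= [-> [_]]|z]//.
    congr (nu _); apply/seteqP; split => z /=.
      by move=> Az; have [->|zy] := eqVneq z y; [left|right; split => //; apply/eqP].
    by move=> [->|[]//]; rewrite inE in yA.
  rewrite [nu (A `\ y)]nu0; last 2 first.
  - exact: measurableD.
  - by move=> x; rewrite inE => /orP[/eqP -> [_ /(_ erefl)]|/At xA [/xA]].
  by rewrite adde0 indicE yA mulr1 fy -EFinD subrr.
have -> : nu B = (nu' B + (fine (nu [set y]) * \1_B y)%:E)%E.
  by rewrite nu'E -addeA -EFinD mulNr addNr adde0.
rewrite {}H EFinD addeC; congr (_ + _%:E)%E.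
congr EFin; rewrite !big_map; apply: eq_big_seq => x xt /=; congr (fine _ * _).
rewrite nu'E indicE memNset ?mulr0 ?adde0//= => xy.
by move: yt; rewrite xy xt.
Qed.

End interpolation.

Section spectral_measure_calculus.
Variables (R : realType) (p N : nat) (pN : (p <= N)%N).
Implicit Types (X : 'M[R[i]]_N) (S : matrix_measure R p).

Lemma mxpowE X k : X \is hermsymmx -> X ^+ k = fcalc (fun x => x ^+ k) X.
Proof.
move=> hX; elim: k => [|k IH].
  rewrite (_ : (fun x => _) = fun=> 1); last by apply/funext => x; rewrite expr0.
  by rewrite fcalc_cst.
rewrite exprS IH (_ : (fun x : R => x ^+ k.+1) = fun x => x * x ^+ k); last first.
  by apply/funext => x; rewrite exprS.
by rewrite (fcalcM hX id (fun x => x ^+ k)) fcalc_id.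
Qed.

Lemma spectrum_eigenval X x : X \is hermsymmx -> spectrum X x ->
  exists a, eigenval X a = x.
Proof.
move=> hX /eigenvalueP[v vX v0].
pose U := spectralmx X; have UU : U^t* *m U = 1%:M := unitarymx_adj (spectral_unitarymx X).
have UU' : U *m U^t* = 1%:M by apply/unitarymxP; exact: spectral_unitarymx.
pose u := v *m U^t*.
have uD : u *m real_diag (eigenval X) = x%:C *: u.
  rewrite /u scalemxAl -vX [in RHS](hermsymmx_spectral hX) -/U.
  by rewrite -!mulmxA UU' mulmx1.
have [[a ua]|u0] := pselect (exists a, u 0 a != 0); last first.
  case/eqP: v0; rewrite -[v]mulmx1 -UU mulmxA -/u.
  rewrite (_ : u = 0) ?mul0mx//; apply/rowP => a; rewrite [RHS]mxE.
  by apply/eqP/negPn/negP => ua; apply: u0; exists a.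
exists a; have /rowP/(_ a) := uD; rewrite /real_diag mul_mx_diag [RHS]mxE.
rewrite [LHS]mxE [X in _ * X]mxE mulrC => /(mulIf ua) [] E.
exact: E.
Qed.

Section uniqueness.
Variables (X : 'M[R[i]]_N) (S : matrix_measure R p).
Hypothesis XS : is_spectral_measure pN X S.

Let hX : X \is hermsymmx. Proof. by case: XS. Qed.

Let t := undup [seq eigenval X a | a <- index_enum 'I_N].

Let ut : uniq t. Proof. exact: undup_uniq. Qed.

Let eigt a : eigenval X a \in t.
Proof. by rewrite mem_undup; apply: map_f; rewrite mem_index_enum. Qed.

Let spectrumt x : spectrum X x -> x \in t.
Proof. by move=> /(spectrum_eigenval hX)[a <-]. Qed.

Let mm_psd B : measurable B -> psdmx (mm_eval S B).
Proof. by case: S B => re im H B mB; exact: H. Qed.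

Let mm_null B : measurable B -> (forall x, x \in t -> ~ B x) -> mm_eval S B = 0.
Proof.
move=> mB Bt; have [_ S0 _] := XS.
have mS : measurable (~` spectrum X).
  apply: measurableC; apply: countable_measurable.
    by move=> x; exact: measurable_set1.
  apply: finite_set_countable; apply: (@sub_finite_set _ _ [set` t]).
    by move=> x /spectrumt.
  exact: finite_seq.
have mD : measurable (~` spectrum X `\` B) by exact: measurableD.
apply: (psdmx_addr0 (mm_psd mB) (mm_psd mD)).
rewrite -S0; apply/matrixP => i j; rewrite !mxE.
have E (nu : {charge set R -> \bar R}) :
    fine (nu B) + fine (nu (~` spectrum X `\` B)) = fine (nu (~` spectrum X)).
  rewrite -fineD ?fin_num_measure// -chargeU//; last by rewrite setDIK.
  by rewrite setDUK// => x Bx /spectrumt /Bt.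
by rewrite -!E; apply/eqP; rewrite eq_complex/= !eqxx.
Qed.

Let re_null i j B : measurable B -> (forall x, x \in t -> ~ B x) ->
  mm_re S i j B = 0%E.
Proof.
move=> mB Bt; have /matrixP/(_ i j) := mm_null mB Bt; rewrite !mxE => -[H _].
by rewrite -[LHS]fineK ?fin_num_measure// H.
Qed.

Let im_null i j B : measurable B -> (forall x, x \in t -> ~ B x) ->
  mm_im S i j B = 0%E.
Proof.
move=> mB Bt; have /matrixP/(_ i j) := mm_null mB Bt; rewrite !mxE => -[_ H].
by rewrite -[LHS]fineK ?fin_num_measure// H.
Qed.

Let mass i j x : R[i] := fine (mm_re S i j [set x]) +i* fine (mm_im S i j [set x]).

Let evalE i j B : measurable B -> mm_eval S B i j =
  \sum_(x <- t) (\1_B x)%:C * mass i j x.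
Proof.
move=> mB; rewrite mxE.
rewrite (charge_finite_support ut (re_null i j) mB).
rewrite (charge_finite_support ut (im_null i j) mB) !big_map/=.
apply/eqP; rewrite eq_complex/= !raddf_sum/=; apply/andP; split;
  apply/eqP/eq_bigr => x _; by rewrite mul0r ?subr0 ?addr0 mulrC.
Qed.

Let momentE i j k : (X ^+ k) (widen_ord pN i) (widen_ord pN j) =
  \sum_(x <- t) (x ^+ k)%:C * mass i j x.
Proof.
have [_ _ ->] := XS; rewrite mxE.
have mX : measurable_fun setT (fun x : R => x ^+ k) by exact: measurable_funX.
rewrite (charge_integral_atomic mX (charge_finite_support ut (re_null i j))).
rewrite (charge_integral_atomic mX (charge_finite_support ut (im_null i j))).
rewrite !big_map/=.
apply/eqP; rewrite eq_complex/= !raddf_sum/=; apply/andP; split;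
  apply/eqP/eq_bigr => x _; by rewrite mul0r ?subr0 ?addr0 mulrC.
Qed.

(** The moments determine the integrals of polynomials, and some polynomial
    coincides with the indicator function on the finite spectrum. *)
Lemma spectral_measure_unique B : measurable B ->
  mm_eval S B = mxsub (widen_ord pN) (widen_ord pN) (fcalc (\1_B) X).
Proof.
move=> mB; apply/matrixP => i j; rewrite evalE// [RHS]mxE.
have [q qB] := interpolation (\1_B) ut.
pose w a := (spectralmx X a (widen_ord pN i))^* * spectralmx X a (widen_ord pN j).
have powE k : \sum_a (eigenval X a ^+ k)%:C * w a =
    \sum_(x <- t) (x ^+ k)%:C * mass i j x.
  by rewrite -momentE mxpowE// fcalc_entry.
have polyE (f : R[i] -> R[i]) (I : Type) (s : seq I) (y : I -> R) (m : I -> R[i]) :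
    \sum_(e <- s) (q.[y e])%:C * m e =
    \sum_(k < size q) (q`_k)%:C * \sum_(e <- s) (y e ^+ k)%:C * m e.
  under [RHS]eq_bigr do rewrite mulr_sumr.
  rewrite exchange_big/=; apply: eq_bigr => e _.
  rewrite horner_coef rmorph_sum mulr_suml; apply: eq_bigr => k _.
  by rewrite rmorphM mulrA.
transitivity (\sum_(x <- t) (q.[x])%:C * mass i j x).
  by apply: eq_big_seq => x xt; rewrite qB.
rewrite (polyE id) fcalc_entry//.
transitivity (\sum_a (q.[eigenval X a])%:C * w a); last first.
  by apply: eq_bigr => a _; rewrite qB.
by rewrite (polyE id); apply: eq_bigr => k _; rewrite powE.
Qed.

End uniqueness.

(** Both sides vanish when X is not Hermitian: the spectral measure is then the
    zero measure, and fcalc is 0. *)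
Lemma mm_eval_spectral_measure X B : measurable B ->
  mm_eval (spectral_measure pN X) B =
  mxsub (widen_ord pN) (widen_ord pN) (fcalc (\1_B) X).
Proof.
move=> mB; have [hX|hX] := boolP (X \is hermsymmx).
  exact: (@spectral_measure_unique X _ (spectral_measureP pN hX) B mB).
rewrite /spectral_measure xgetPN => [|S [hX' _ _]]; last by rewrite hX' in hX.
by rewrite fcalc_nherm//; apply/matrixP => i j; rewrite !mxE.
Qed.

Lemma measurable_spectral_measure :
  measurable_fun setT (spectral_measure pN : cmx R N N -> mmeasurable R p).
Proof.
apply: (@measurability _ _ (cmx R N N) (mmeasurable R p) setT _ (@mm_eval_sets R p)).
  by [].
move=> _ [_ [B [E [mB mE ->]]] <-].
have mF : measurable_fun setT ((fun X => mxsub (widen_ord pN) (widen_ord pN)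
    (fcalc (\1_B) X)) : cmx R N N -> cmx R p p).
  apply: (measurable_submx (T := cmx R N N)); exact: calc_measurable_indic.
have := mF measurableT E mE; congr measurable.
congr (_ `&` _); apply/seteqP; split => X /=; by rewrite mm_eval_spectral_measure.
Qed.

End spectral_measure_calculus.

(** * Conditioning and corner-preserving conjugations *)

Section exchange.
Variable R : realType.

Lemma law_integral d (T : measurableType d) (P : probability T R)
    d' (T' : measurableType d') (P' : probability T' R)
    d1 (E : measurableType d1) (X : T -> E) (X' : T' -> E) (h : E -> \bar R) :
  measurable_fun setT X -> measurable_fun setT X' ->
  (forall A, measurable A -> P (X @^-1` A) = P' (X' @^-1` A)) ->
  measurable_fun setT h -> (forall x, 0 <= h x)%E ->
  (\int[P]_w h (X w) = \int[P']_w h (X' w))%E.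
Proof.
move=> mX mX' XX' mh h0.
pose Y : {mfun T >-> E} := HB.pack X (isMeasurableFun.Build _ _ _ _ _ mX).
pose Y' : {mfun T' >-> E} := HB.pack X' (isMeasurableFun.Build _ _ _ _ _ mX').
transitivity (\int[distribution P Y]_x h x)%E.
  by rewrite ge0_integral_distribution.
transitivity (\int[distribution P' Y']_x h x)%E.
  by apply: eq_measure_integral => A mA _; exact: XX'.
by rewrite ge0_integral_distribution.
Qed.

(** By Fubini, both probabilities are integrals of the same function of the first
    component, with respect to the same law. *)
Lemma independent2_exchange d (T : measurableType d) (P : probability T R)
    d' (T' : measurableType d') (P' : probability T' R)
    d1 (E : measurableType d1) d2 (E2 : measurableType d2)
    d2' (E2' : measurableType d2')
    (X : T -> E) (Y : T -> E2) (X' : T' -> E) (Y' : T' -> E2')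
    (F : set (E * E2)) (F' : set (E * E2')) :
  measurable_fun setT X -> measurable_fun setT Y ->
  measurable_fun setT X' -> measurable_fun setT Y' ->
  independent2 P X Y -> independent2 P' X' Y' ->
  (forall A, measurable A -> P (X @^-1` A) = P' (X' @^-1` A)) ->
  measurable F -> measurable F' ->
  (forall x, P [set w | F (x, Y w)] = P' [set w | F' (x, Y' w)]) ->
  P [set w | F (X w, Y w)] = P' [set w | F' (X' w, Y' w)].
Proof.
move=> mX mY mX' mY' iXY iXY' XX' mF mF' FF'.
rewrite (independent2_fubini mX mY iXY mF) (independent2_fubini mX' mY' iXY' mF').
under [RHS]eq_integral do rewrite -FF'.
pose Z : {mfun T >-> E2} := HB.pack Y (isMeasurableFun.Build _ _ _ _ _ mY).
apply: (law_integral (h := fun x => P [set w | F (x, Y w)]) mX mX' XX').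
  have := measurable_fun_xsection (distribution P Z) mF.
  congr measurable_fun; apply/funext => x; rewrite /= /pushforward; congr (P _).
  by apply/seteqP; split => w; rewrite /xsection /= inE.
by move=> x; exact: measure_ge0.
Qed.

End exchange.

Section invariance.
Variables (R : realType) (p : nat).

(** The subgroup of the unitary group that fixes the first p vectors of the
    canonical basis. *)
Definition fixes_corner N (V : 'M[R[i]]_N) :=
  V \is unitarymx /\ V *m pid_mx p = pid_mx p :> 'M[R[i]]_(N, p).

(** One inclusion is enough, since the adjoint of V fixes the corner as well. *)
Definition corner_invariant N (F : set 'M[R[i]]_N) :=
  forall V X, fixes_corner V -> F X -> F (V *m X *m V^t*).

Lemma fixes_corner_adj N (V : 'M[R[i]]_N) : fixes_corner V -> fixes_corner (V^t*).
Proof.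
move=> [uV Vp]; split; first by rewrite trmxC_unitary.
by rewrite -{1}Vp mulmxA (unitarymx_adj uV) mul1mx.
Qed.

Lemma corner_entry N (pN : (p <= N)%N) (A : 'M[R[i]]_N) :
  mxsub (widen_ord pN) (widen_ord pN) A =
  (pid_mx p : 'M[R[i]]_(N, p))^t* *m A *m (pid_mx p : 'M[R[i]]_(N, p)).
Proof.
rewrite tr_pid_mx map_pid_mx; apply/matrixP => i j; rewrite !mxE.
rewrite (bigD1 (widen_ord pN j))//= [X in _ + X]big1 => [|k kj]; last first.
  rewrite [X in _ * X]mxE (_ : (k == j :> nat) = false) ?mulr0//.
  by apply/negbTE; apply: contra kj => /eqP kj; apply/eqP/val_inj.
rewrite addr0 [X in _ * X]mxE /= eqxx ltn_ord mulr1 mxE.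
rewrite (bigD1 (widen_ord pN i))//= big1 => [|k ki]; last first.
  rewrite [X in X * _]mxE (_ : (i == k :> nat) = false) ?mul0r//.
  by apply/negbTE; apply: contra ki => /eqP ki; apply/eqP/val_inj.
by rewrite addr0 [X in X * _]mxE /= eqxx ltn_ord mul1r.
Qed.

Lemma spectrum_conj N (V X : 'M[R[i]]_N) : V \is unitarymx ->
  spectrum X `<=` spectrum (V *m X *m V^t*).
Proof.
move=> uV x /eigenvalueP[v vX v0]; apply/eigenvalueP; exists (v *m V^t*).
  by rewrite !mulmxA mulmxKtV// vX scalemxAl.
apply/eqP => /(congr1 (mulmx^~ V)); rewrite mulmxKtV// mul0mx => /eqP.
exact/negP.
Qed.

Lemma mxpow_conj N (V X : 'M[R[i]]_N) k : V \is unitarymx ->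
  (V *m X *m V^t*) ^+ k = V *m X ^+ k *m V^t*.
Proof.
move=> uV; elim: k => [|k IH].
  by rewrite !expr0 mulmx1; have /unitarymxP -> := uV.
rewrite !exprS IH -![_ * _]/(_ *m _) !mulmxA; congr (_ *m _ *m _).
exact: mulmxKtV uV erefl.
Qed.

(** The conjugation preserves the spectrum and the p x p corner of every power,
    which are all that the defining property of the spectral measure sees. *)
Lemma spectral_measure_conj N (pN : (p <= N)%N) (V X : 'M[R[i]]_N) :
  fixes_corner V ->
  spectral_measure pN (V *m X *m V^t*) = spectral_measure pN X.
Proof.
have half (W Y : 'M[R[i]]_N) (S : matrix_measure R p) : fixes_corner W ->
    is_spectral_measure pN Y S -> is_spectral_measure pN (W *m Y *m W^t*) S.
  move=> cW [hY S0 SY]; have [uW Wp] := cW; have [uW' Wp'] := fixes_corner_adj cW.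
  have WY := unitary_conjK Y uW.
  have spE : spectrum (W *m Y *m W^t*) = spectrum Y.
    apply/seteqP; split=> x; last exact: (spectrum_conj uW).
    by move=> /(spectrum_conj uW'); rewrite trmxCK WY.
  split.
  - by apply/hermsymmxP; rewrite !adjmxM trmxCK (hermsymmxP _ hY) mulmxA.
  - by rewrite spE.
  - move=> k i j; rewrite (mxpow_conj Y k uW); apply: etrans _ (SY k i j).
    have := corner_entry pN (W *m Y ^+ k *m W^t*).
    rewrite (conj_compress (Y ^+ k) Wp') -corner_entry => /matrixP/(_ i j).
    by rewrite mxE => ->; rewrite mxE.
move=> cV; rewrite /spectral_measure; congr (xget _ _).
apply/seteqP; split => S /=; last exact: half.
move=> /(half _ _ _ (fixes_corner_adj cV)); rewrite trmxCK.
by have [uV _] := cV; rewrite (unitary_conjK X uV).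
Qed.

End invariance.

(** * Gram matrices of block triangular matrices *)

Section corner_blocks.
Variables (C : numClosedFieldType) (p N : nat).

(** Z Z^* for the block lower triangular Z = [s, 0; b, z] with z z^* = Y. *)
Definition corner_gram (s : 'M[C]_p) (b : 'M[C]_(N, p)) (Y : 'M[C]_N) :
    'M[C]_(p + N) :=
  block_mx (s *m s^t*) (s *m b^t*) (b *m s^t*) (b *m b^t* + Y).

Lemma adj_block_mx m1 m2 n1 n2 (A : 'M[C]_(m1, n1)) (B : 'M[C]_(m1, n2))
    (D : 'M[C]_(m2, n1)) (E : 'M[C]_(m2, n2)) :
  (block_mx A B D E)^t* = block_mx (A^t*) (D^t*) (B^t*) (E^t*).
Proof. by rewrite tr_block_mx map_block_mx. Qed.

Lemma corner_gramE g (s : 'M[C]_p) (b : 'M[C]_(N, p)) (z : 'M[C]_(N, g)) :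
  block_mx s 0 b z *m (block_mx s 0 b z)^t* = corner_gram s b (z *m z^t*).
Proof.
rewrite adj_block_mx mulmx_block adjmx0 /corner_gram.
by rewrite !mulmx0 !mul0mx !addr0.
Qed.

Lemma corner_gram_conj (V : 'M[C]_N) s b Y :
  corner_gram s (V *m b) (V *m Y *m V^t*) =
  block_mx 1%:M 0 0 V *m corner_gram s b Y *m (block_mx 1%:M 0 0 V)^t*.
Proof.
rewrite adj_block_mx !adjmx0 adjmx1 /corner_gram !mulmx_block.
rewrite !mul0mx !mulmx0 !mul1mx !mulmx1 !addr0 !add0r.
by rewrite !adjmxM mulmxDr mulmxDl !mulmxA.
Qed.

Lemma block1_unitary (V : 'M[C]_N) : V \is unitarymx ->
  block_mx (1%:M : 'M[C]_p) 0 0 V \is unitarymx.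
Proof.
move=> /unitarymxP VV; apply/unitarymxP.
rewrite adj_block_mx !adjmx0 adjmx1 mulmx_block !mul0mx !mulmx0 !mul1mx.
by rewrite !addr0 !add0r VV -scalar_mx_block.
Qed.

Lemma pid_mx_isometry : (p <= N)%N ->
  (pid_mx p : 'M[C]_(N, p))^t* *m (pid_mx p : 'M[C]_(N, p)) = 1%:M.
Proof.
move=> pN; rewrite tr_pid_mx map_pid_mx mul_pid_mx.
by rewrite (minn_idPr _) minnn ?pid_mx_1.
Qed.

(** With e the first p columns of the identity matrix, e *m c has the same Gram
    matrix as b. *)
Lemma corner_polar (b : 'M[C]_(N, p)) (c : 'M[C]_p) : (p <= N)%N ->
  c *m c = b^t* *m b -> c^t* = c ->
  exists2 V : 'M[C]_N, V \is unitarymx & V *m b = pid_mx p *m c.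
Proof.
move=> pN cb hc.
pose ec : 'M[C]_(N, p) := pid_mx p *m c.
have E : b^t* *m b^t*^t* = ec^t* *m ec^t*^t*.
  rewrite !trmxCK adjmxM mulmxA -(mulmxA (c^t*)) pid_mx_isometry//.
  by rewrite mulmx1 hc cb.
have [Q uQ bQ] := gram_unitary E.
exists (Q^t*); first by rewrite trmxC_unitary.
by rewrite -[LHS]trmxCK adjmxM trmxCK bQ trmxCK.
Qed.

Lemma row_polar g (a : 'M[C]_(p, p + g)) (s : 'M[C]_p) :
  s *m s = a *m a^t* -> s^t* = s ->
  exists2 Q : 'M[C]_(p + g), Q \is unitarymx & a *m Q = row_mx s 0.
Proof.
move=> sa hs; apply: gram_unitary.
rewrite tr_row_mx map_col_mx mul_row_col adjmx0 mulmx0 addr0.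
by rewrite hs sa.
Qed.

End corner_blocks.

Section corner_invariance.
Variables (R : realType) (p N : nat).

Lemma fixes_corner_block (V : 'M[R[i]]_N) : V \is unitarymx ->
  @fixes_corner R p (p + N) (block_mx 1%:M 0 0 V).
Proof.
move=> uV; split; first exact: block1_unitary.
by rewrite pid_mx_col mul_block_col !mulmx1 !mulmx0 !addr0.
Qed.

Lemma corner_gram_invariant (F : set 'M[R[i]]_(p + N)) (V : 'M[R[i]]_N) s b Y :
  @corner_invariant R p _ F -> V \is unitarymx ->
  F (corner_gram s b Y) = F (corner_gram s (V *m b) (V *m Y *m V^t*)).
Proof.
move=> iF uV; apply: propext; rewrite corner_gram_conj.
have fV := fixes_corner_block uV.
split=> [FY|]; first exact: iF.
move=> /(iF _ _ (fixes_corner_adj fV)); rewrite trmxCK.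
by rewrite (unitary_conjK _ (block1_unitary p uV)).
Qed.

Lemma corner_slice_invariant (F : set 'M[R[i]]_(p + N)) (s c : 'M[R[i]]_p) :
  @corner_invariant R p _ F ->
  @corner_invariant R p N [set Y | F (corner_gram s (pid_mx p *m c) Y)].
Proof.
move=> iF V Y [uV Vp] /=; rewrite (corner_gram_invariant s _ Y iF uV).
by rewrite mulmxA Vp.
Qed.

Section measurability.
Context d (T : measurableType d).

Lemma measurable_corner_gram (s : T -> 'M[R[i]]_p) (b : T -> 'M[R[i]]_(N, p))
    (Y : T -> 'M[R[i]]_N) :
  measurable_fun setT (s : T -> cmx R p p) ->
  measurable_fun setT (b : T -> cmx R N p) ->
  measurable_fun setT (Y : T -> cmx R N N) ->
  measurable_fun setT ((fun w => corner_gram (s w) (b w) (Y w)) :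
    T -> cmx R (p + N) (p + N)).
Proof.
move=> ms mb mY; apply: measurable_block_mx.
- by apply: measurable_mulmx => //; exact: measurable_adjmx.
- by apply: measurable_mulmx => //; exact: measurable_adjmx.
- by apply: measurable_mulmx => //; exact: measurable_adjmx.
- apply: measurable_addmx => //.
  by apply: measurable_mulmx => //; exact: measurable_adjmx.
Qed.

Lemma measurable_gram m n (G : T -> 'M[R[i]]_(m, n)) :
  measurable_fun setT (G : T -> cmx R m n) ->
  measurable_fun setT ((fun w => G w *m (G w)^t*) : T -> cmx R m m).
Proof. by move=> mG; apply: measurable_mulmx => //; exact: measurable_adjmx. Qed.

End measurability.

End corner_invariance.

(** * Freezing blocks of a Gaussian matrix *)

Section gaussian_peeling.
Variables (R : realType) (p N M : nat).
Context d (T : measurableType d) (P : probability T R).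
Variable G : T -> 'M[R[i]]_(p + N, p + M).
Hypothesis gG : complex_gaussian_mx P G.

Definition top_rows (X : 'M[R[i]]_(p + N, p + M)) := mxsub (lshift N) id X.
Definition bottom_rows (X : 'M[R[i]]_(p + N, p + M)) := mxsub (@rshift p N) id X.
Definition bottom_left (X : 'M[R[i]]_(p + N, p + M)) :=
  mxsub (@rshift p N) (lshift M) X.
Definition bottom_right (X : 'M[R[i]]_(p + N, p + M)) :=
  mxsub (@rshift p N) (@rshift p M) X.

Lemma col_mx_rows X : X = col_mx (top_rows X) (bottom_rows X).
Proof.
apply/matrixP => i j; case: (split_ordP i) => k ->.
  by rewrite col_mxEu mxE.
by rewrite col_mxEd mxE.
Qed.

Lemma bottom_rowsE X : bottom_rows X = row_mx (bottom_left X) (bottom_right X).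
Proof.
apply/matrixP => i j; case: (split_ordP j) => k ->.
  by rewrite row_mxEl !mxE.
by rewrite row_mxEr !mxE.
Qed.

Lemma gaussian_top : complex_gaussian_mx P (fun w => top_rows (G w)).
Proof. by apply: complex_gaussian_submx => //; exact: lshift_inj. Qed.

Lemma gaussian_bottom : complex_gaussian_mx P (fun w => bottom_rows (G w)).
Proof. by apply: complex_gaussian_submx => //; exact: rshift_inj. Qed.

Lemma gaussian_bottom_left : complex_gaussian_mx P (fun w => bottom_left (G w)).
Proof.
by apply: complex_gaussian_submx => //; [exact: rshift_inj|exact: lshift_inj].
Qed.

Lemma gaussian_bottom_right : complex_gaussian_mx P (fun w => bottom_right (G w)).
Proof. by apply: complex_gaussian_submx => //; exact: rshift_inj. Qed.

Lemma independent_top_bottom : independent2 P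
  ((fun w => top_rows (G w)) : T -> cmx R p (p + M))
  ((fun w => bottom_rows (G w)) : T -> cmx R N (p + M)).
Proof.
apply: complex_gaussian_independent gG => i j i' j' /eqP.
by rewrite eq_lrshift.
Qed.

Lemma independent_bottom : independent2 P
  ((fun w => bottom_left (G w)) : T -> cmx R N p)
  ((fun w => bottom_right (G w)) : T -> cmx R N M).
Proof.
apply: complex_gaussian_independent gG => i j i' j' _ /eqP.
by rewrite eq_lrshift.
Qed.

Variable F : set (cmx R (p + N) (p + N)).
Hypothesis mF : measurable F.
Hypothesis iF : @corner_invariant R p _ F.

(** With the top rows frozen, a right unitary factor makes them [s, 0]; it
    changes neither G G^* nor the law of the bottom rows. *)
Lemma freeze_top (a : 'M[R[i]]_(p, p + M)) (s : 'M[R[i]]_p) :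
  s *m s = a *m a^t* -> s^t* = s ->
  P [set w | F (col_mx a (bottom_rows (G w)) *m (col_mx a (bottom_rows (G w)))^t*)] =
  P [set w | F (corner_gram s (bottom_left (G w))
                 (bottom_right (G w) *m (bottom_right (G w))^t*))].
Proof.
move=> sa hs; have [Q uQ aQ] := row_polar sa hs.
pose H (B : 'M[R[i]]_(N, p + M)) := col_mx (row_mx s 0) B *m (col_mx (row_mx s 0) B)^t*.
have mH : measurable_fun setT (H : cmx R N (p + M) -> cmx R (p + N) (p + N)).
  apply: (measurable_gram (T := cmx R N (p + M))).
  apply/(measurable_cmxP (T := cmx R N (p + M))) => i j.
  case: (split_ordP i) => k ->.
    under eq_fun do rewrite col_mxEu; exact: measurable_cfun_cst.
  under eq_fun do rewrite col_mxEd.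
  have mid : measurable_fun setT (idfun : cmx R N (p + M) -> cmx R N (p + M)).
    exact: measurable_id.
  by have /measurable_cmxP := mid; apply.
have mA : measurable (H @^-1` F : set (cmx R N (p + M))) by rewrite -[X in measurable X]setTI; exact: mH.
have := complex_gaussian_law (complex_gaussian_mulmxr uQ gaussian_bottom)
  gaussian_bottom mA.
have E1 : (fun w => bottom_rows (G w) *m Q) @^-1` (H @^-1` F) =
    [set w | F (col_mx a (bottom_rows (G w)) *m (col_mx a (bottom_rows (G w)))^t*)].
  apply/seteqP; suff E w : H (bottom_rows (G w) *m Q) =
      col_mx a (bottom_rows (G w)) *m (col_mx a (bottom_rows (G w)))^t*.
    by split=> w /=; rewrite E.
  rewrite /H -aQ -mul_col_mx adjmxM mulmxA -(mulmxA _ Q).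
  by have /unitarymxP -> := uQ; rewrite mulmx1.
have E2 : (fun w => bottom_rows (G w)) @^-1` (H @^-1` F) =
    [set w | F (corner_gram s (bottom_left (G w))
                 (bottom_right (G w) *m (bottom_right (G w))^t*))].
  apply/seteqP; suff E w : H (bottom_rows (G w)) = corner_gram s
      (bottom_left (G w)) (bottom_right (G w) *m (bottom_right (G w))^t*).
    by split=> w /=; rewrite E.
  by rewrite -corner_gramE /H bottom_rowsE -block_mxEv.
by rewrite E1 E2.
Qed.

(** With the bottom left block frozen, a left unitary factor that fixes the
    corner carries it onto its first p rows. *)
Lemma freeze_bottom_left (b : 'M[R[i]]_(N, p)) (s c : 'M[R[i]]_p) : (p <= N)%N ->
  c *m c = b^t* *m b -> c^t* = c ->
  P [set w | F (corner_gram s b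
                 (bottom_right (G w) *m (bottom_right (G w))^t*))] =
  P [set w | F (corner_gram s (pid_mx p *m c)
                 (bottom_right (G w) *m (bottom_right (G w))^t*))].
Proof.
move=> pN cb hc; have [V uV Vb] := corner_polar pN cb hc.
pose H (g : 'M[R[i]]_(N, M)) := corner_gram s (pid_mx p *m c) (g *m g^t*).
have mH : measurable_fun setT (H : cmx R N M -> cmx R (p + N) (p + N)).
  apply: (measurable_corner_gram (T := cmx R N M)).
  - exact: measurable_cst.
  - exact: measurable_cst.
  - apply: (measurable_gram (T := cmx R N M)); exact: measurable_id.
have mA : measurable (H @^-1` F : set (cmx R N M)) by rewrite -[X in measurable X]setTI; exact: mH.
have := complex_gaussian_law (complex_gaussian_mulmxl uV gaussian_bottom_right)
  gaussian_bottom_right mA.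
have -> : (fun w => V *m bottom_right (G w)) @^-1` (H @^-1` F) =
    [set w | F (corner_gram s b
                 (bottom_right (G w) *m (bottom_right (G w))^t*))].
  apply/funext => w; apply: esym.
  apply: (etrans (corner_gram_invariant s b _ iF uV)).
  by rewrite Vb /preimage /= /H adjmxM !mulmxA.
by [].
Qed.

End gaussian_peeling.

(** * Block bidiagonal matrices *)

Section bidiagonal.
Variables (R : realType) (p : nat).

Section slices.
Context d (T : measurableType d).

Lemma measurable_preimageT d2 (U : measurableType d2) (f : T -> U) (A : set U) :
  measurable_fun setT f -> measurable A -> measurable (f @^-1` A).
Proof. by move=> mf mA; rewrite -[X in measurable X]setTI; exact: mf. Qed.

Lemma measurable_corner_slice N (F : set (cmx R (p + N) (p + N)))
    (s : T -> 'M[R[i]]_p) (b : T -> 'M[R[i]]_(N, p)) (Y : T -> 'M[R[i]]_N) :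
  measurable F ->
  measurable_fun setT (s : T -> cmx R p p) ->
  measurable_fun setT (b : T -> cmx R N p) ->
  measurable_fun setT (Y : T -> cmx R N N) ->
  measurable [set w | F (corner_gram (s w) (b w) (Y w))].
Proof.
move=> mF ms mb mY.
exact: (measurable_preimageT (measurable_corner_gram ms mb mY) mF).
Qed.

End slices.

(** The number p * n.+1, in the recursive form that block matrices require. *)
Fixpoint bsize n : nat := if n is n'.+1 then (p + bsize n')%N else p.

Lemma bsizeE n : bsize n = (p * n.+1)%N.
Proof. by elim: n => [|n IH] /=; rewrite ?muln1// IH [RHS]mulnS. Qed.

Lemma leq_bsize n : (p <= bsize n)%N.
Proof. by case: n => //= n; exact: leq_addr. Qed.

Fixpoint bidiag n (D C : nat -> 'M[R[i]]_p) : 'M[R[i]]_(bsize n) :=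
  if n is n'.+1 then
    block_mx (D 0%N) 0 (pid_mx p *m C 0%N)
      (bidiag n' (fun k => D k.+1) (fun k => C k.+1))
  else D 0%N.

Lemma measurable_bidiag d (T : measurableType d) n (D C : nat -> T -> 'M[R[i]]_p) :
  (forall k, (k <= n)%N -> measurable_fun setT (D k : T -> cmx R p p)) ->
  (forall k, (k < n)%N -> measurable_fun setT (C k : T -> cmx R p p)) ->
  measurable_fun setT ((fun w => bidiag n (D^~ w) (C^~ w)) :
    T -> cmx R (bsize n) (bsize n)).
Proof.
elim: n D C => [|n IH] D C mD mC; first exact: mD.
apply: measurable_block_mx.
- exact: mD.
- exact: measurable_cst.
- by apply: measurable_mulmx; [exact: measurable_cst|exact: mC].
- apply: (IH (fun k => D k.+1) (fun k => C k.+1)) => k kn; first exact: mD.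
  exact: mC.
Qed.

Lemma bidiag_gramS n (D C : nat -> 'M[R[i]]_p) :
  bidiag n.+1 D C *m (bidiag n.+1 D C)^t* =
  corner_gram (D 0%N) (pid_mx p *m C 0%N)
    (bidiag n (fun k => D k.+1) (fun k => C k.+1) *m
     (bidiag n (fun k => D k.+1) (fun k => C k.+1))^t*).
Proof. exact: corner_gramE. Qed.

Lemma bsize_sum n : bsize n = (\sum_(i < n.+1) p)%N.
Proof. by rewrite bsizeE sum_nat_const card_ord mulnC. Qed.

Lemma castmx_pid_mx N x (e : N = (p + x)%N) (c : 'M[R[i]]_p) :
  castmx (e, erefl p) (pid_mx p *m c : 'M[R[i]]_(N, p)) = col_mx c 0.
Proof.
subst N; rewrite castmx_id.
by rewrite pid_mx_col mul_col_mx mul1mx mul0mx.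
Qed.

Lemma castmx_corner N N' M (e : N = N') (e' : (p + N')%N = M)
    (A : 'M[R[i]]_p) (B : 'M[R[i]]_(N, p)) (Y : 'M[R[i]]_N)
    (e'' : (p + N)%N = M) :
  castmx (e', e') (block_mx A 0 (castmx (e, erefl p) B) (castmx (e, e) Y)) =
  castmx (e'', e'') (block_mx A 0 B Y).
Proof.
subst N'; rewrite !castmx_id.
by rewrite (eq_irrelevance e' e'').
Qed.

Lemma castmx_block_mx0 x M (e : (p + x)%N = M) (f : p = M) (A : 'M[R[i]]_p) B Y Z :
  castmx (e, e) (block_mx A B Y Z) = castmx (f, f) A.
Proof.
case: _ / f e => e; apply/matrixP => i j; rewrite castmx_id castmxE /=.
have E k : cast_ord (esym e) k = lshift x k by apply/val_inj.
by rewrite !E block_mxEul.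
Qed.

Lemma block_bidiagE n (D C : nat -> 'M[R[i]]_p) :
  block_bidiag n.+1 D C = castmx (bsize_sum n, bsize_sum n)
    (bidiag n (fun k => D k.+1) (fun k => C k.+1)).
Proof.
elim: n D C => [|n IH] D C.
  rewrite /block_bidiag mxblock_recul.
  by apply: castmx_block_mx0.
rewrite /block_bidiag mxblock_recul.
rewrite (_ : \mxrow_j _ = 0); last first.
  by rewrite -[RHS](mxrow0 _); apply/eq_mxrow => j.
rewrite (_ : \mxcol_i _ = castmx (bsize_sum n, erefl p) (pid_mx p *m C 1%N));
  last first.
  rewrite mxcol_recu (_ : \mxcol_j _ = 0); last first.
    by rewrite -[RHS](mxcol0 _); apply/eq_mxcol => j.
  have eb : bsize n = (p + \sum_(i < n) p)%N by rewrite bsize_sum big_ord_recl.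
  by rewrite -(castmx_pid_mx eb) castmx_comp; exact: eq_castmx.
rewrite (_ : \mxblock_(_, _) _ = castmx (bsize_sum n, bsize_sum n)
  (bidiag n (fun k => D k.+2) (fun k => C k.+2))); last first.
  rewrite -(IH (fun k => D k.+1) (fun k => C k.+1)); apply/eq_mxblock => i j.
  by [].
exact: castmx_corner.
Qed.

Section law.
Context d (T : measurableType d) (P : probability T R).
Context d' (T' : measurableType d') (P' : probability T' R).

Lemma LUE_law N g g' (X : T -> 'M[R[i]]_N) (G : T' -> 'M[R[i]]_(N, g')) :
  g = g' -> LUE_distributed P g X -> complex_gaussian_mx P' G ->
  forall A : set (cmx R N N), measurable A ->
  P (X @^-1` A) = P' [set w | A (G w *m (G w)^t*)].
Proof.
move=> eg; case: _ / eg G => G [d0 [T0 [P0 [G0 [gG0 [_ _ XG0]]]]]] gG A mA.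
have := XG0 A mA; rewrite /pushforward => ->.
pose H (M : 'M[R[i]]_(N, g)) := M *m M^t*.
have mH : measurable_fun setT (H : cmx R N g -> cmx R N N).
  by apply: (measurable_gram (T := cmx R N g)); exact: measurable_id.
have mA' : measurable (H @^-1` A : set (cmx R N g)).
  by rewrite -[X in measurable X]setTI; exact: mH.
exact: (complex_gaussian_law gG0 gG mA').
Qed.

(** A positive semidefinite matrix is the square root of its square, hence its
    law is determined by the law of its square. *)
Lemma psd_LUE_law N g g' (S : T -> 'M[R[i]]_N) (G : T' -> 'M[R[i]]_(N, g')) :
  g = g' -> (forall w, psdmx (S w)) ->
  LUE_distributed P g (fun w => S w *m S w) -> complex_gaussian_mx P' G ->
  forall A : set (cmx R N N), measurable A ->
  P (S @^-1` A) = P' ((fun w => msqrt (G w *m (G w)^t*)) @^-1` A).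
Proof.
move=> gg' psdS LS gG A mA.
have mA' : measurable (@msqrt R N @^-1` A : set (cmx R N N)).
  by rewrite -[X in measurable X]setTI; exact: measurable_msqrt.
rewrite -(LUE_law gg' LS gG mA'); congr (P _); apply/funext => w.
by rewrite /preimage /= msqrt_sqr.
Qed.

End law.

(** Both sides are brought to the form corner_gram s (pid_mx p *m c) Y, where s,
    c and Y are independent. On the side of Z Z^*, this is the block structure,
    with s = D 0, c = C 0 and Y the Gram matrix of the remaining bidiagonal
    matrix. On the side of G G^*, the top p rows are frozen and replaced by
    [s, 0], then the first p columns of the remaining rows are frozen and replaced
    by pid_mx p *m c; there s and c are the square roots of the Gram matrices of
    the frozen blocks and Y is the Gram matrix of the untouched lower right block.
    The laws of s and c agree by hypothesis, and those of Y by induction. The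
    unitary factor that reduces the frozen columns conjugates the whole Gram
    matrix, which is why F has to be corner invariant; so are its slices with s
    and c frozen, to which the induction hypothesis applies. *)
Lemma bidiag_gram_law n : forall m (nm : (n <= m)%N)
  d (T : measurableType d) (P : probability T R) (D C : nat -> T -> 'M[R[i]]_p)
  (mD : forall k, (k <= n)%N -> measurable_fun setT (D k : T -> cmx R p p))
  (mC : forall k, (k < n)%N -> measurable_fun setT (C k : T -> cmx R p p))
  (psdD : forall k, (k <= n)%N -> forall w, psdmx (D k w))
  (psdC : forall k, (k < n)%N -> forall w, psdmx (C k w))
  (iDC : mutually_independent P (fun s : 'I_n.+1 + 'I_n =>
     (match s with inl k => D k | inr k => C k end) : T -> cmx R p p))
  (LD : forall k, (k <= n)%N ->
     LUE_distributed P (p * (m - k).+1) (fun w => D k w *m D k w))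
  (LC : forall k, (k < n)%N ->
     LUE_distributed P (p * (n - k)) (fun w => C k w *m C k w))
  d' (T' : measurableType d') (P' : probability T' R)
  (G : T' -> 'M[R[i]]_(bsize n, bsize m)) (gG : complex_gaussian_mx P' G)
  (F : set (cmx R (bsize n) (bsize n))), measurable F ->
  @corner_invariant R p _ F ->
  P [set w | F (bidiag n (D^~ w) (C^~ w) *m (bidiag n (D^~ w) (C^~ w))^t*)] =
  P' [set w | F (G w *m (G w)^t*)].
Proof.
elim: n => [|n IH] m nm d T P D C mD mC psdD psdC iDC LD LC d' T' P' G gG F mF iF.
  have eg : (p * (m - 0).+1)%N = bsize m by rewrite subn0 bsizeE.
  rewrite -(LUE_law eg (LD 0%N isT) gG mF).
  congr (P _); apply/funext => w /=; have [hD _] := psdD 0%N isT w.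
  by rewrite (hermsymmxP _ hD).
case: m nm LD G gG => // m nm LD G gG.
pose D' k := D k.+1; pose C' k := C k.+1.
pose Z w := bidiag n (D'^~ w) (C'^~ w).
pose Y w := Z w *m (Z w)^t*.
pose X (s : 'I_n.+2 + 'I_n.+1) : T -> cmx R p p :=
  match s with inl k => D k | inr k => C k end.
have mX s : measurable_fun setT (X s).
  by case: s => k; [apply: mD; exact: (ltn_ord k)|apply: mC; exact: (ltn_ord k)].
have mY : measurable_fun setT (Y : T -> cmx R (bsize n) (bsize n)).
  apply: measurable_gram; apply: measurable_bidiag => k kn; first exact: mD.
  exact: mC.
pose J0 : {set 'I_n.+2 + 'I_n.+1} := [set inl ord0]%SET.
pose J1 : {set 'I_n.+2 + 'I_n.+1} := [set inr ord0]%SET.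
have mYK (K : {set 'I_n.+2 + 'I_n.+1}) : (forall s, s \notin J0 :|: J1 -> s \in K)%SET ->
    measurable_fun setT (Y : g_sigma_algebraType (cylinders X K) -> cmx R (bsize n) (bsize n)).
  move=> subK; apply: measurable_gram; apply: measurable_bidiag => k kn.
    pose i : 'I_n.+2 := Ordinal (kn : (k.+1 < n.+2)%N).
    by apply: (measurable_generated_by (X := X) (j := inl i)); apply: subK; rewrite !inE.
  pose i : 'I_n.+1 := Ordinal (kn : (k.+1 < n.+1)%N).
  by apply: (measurable_generated_by (X := X) (j := inr i)); apply: subK; rewrite !inE.
have iD : independent2 P (D 0%N : T -> cmx R p p)
    ((fun w => (C 0%N w, Y w)) : T -> (cmx R p p * cmx R (bsize n) (bsize n))%type).
  move=> A B mA mB; apply: (independent_groups mX iDC (J := J0) (K := ~: J0)%SET).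
  - by rewrite finset.disjoints_subset finset.setCK.
  - by apply: (generated_by_preimage (X := X) (j := inl ord0)); rewrite ?inE.
  - apply: generated_by_fun mB; apply: measurable_fun_pair.
      by apply: (measurable_generated_by (X := X) (j := inr ord0)); rewrite !inE.
    by apply: mYK => s; rewrite !inE negb_or => /andP[].
have iC : independent2 P (C 0%N : T -> cmx R p p) (Y : T -> cmx R (bsize n) (bsize n)).
  move=> A B mA mB; apply: (independent_groups mX iDC (J := J1) (K := ~: J1)%SET).
  - by rewrite finset.disjoints_subset finset.setCK.
  - by apply: (generated_by_preimage (X := X) (j := inr ord0)); rewrite ?inE.
  - apply: generated_by_fun mB.
    by apply: mYK => s; rewrite !inE negb_or => /andP[].
pose tp w := @top_rows R p (bsize n) (bsize m) (G w).
pose bt w := @bottom_rows R p (bsize n) (bsize m) (G w).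
pose bl w := @bottom_left R p (bsize n) (bsize m) (G w).
pose br w := @bottom_right R p (bsize n) (bsize m) (G w).
have mtp := complex_gaussian_measurable (gaussian_top gG).
have mbt := complex_gaussian_measurable (gaussian_bottom gG).
have mbl := complex_gaussian_measurable (gaussian_bottom_left gG).
have mbr := complex_gaussian_measurable (gaussian_bottom_right gG).
have itb := independent_top_bottom gG; have ilr := independent_bottom gG.
pose E1 := cmx R p p; pose EN := cmx R (bsize n) (bsize n).
pose ENp := cmx R (bsize n) p; pose ENm := cmx R (bsize n) (bsize m).
pose lr (B : 'M[R[i]]_(bsize n, p + bsize m)) := (lsubmx B, rsubmx B) : (ENp * ENm)%type.
have btE w : lr (bt w) = (bl w, br w).
  by rewrite /lr /bt bottom_rowsE row_mxKl row_mxKr.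
have mlr : measurable_fun setT (lr : cmx R (bsize n) (p + bsize m) -> (ENp * ENm)%type).
  have lE : lsubmx = mxsub id (lshift (bsize m)) :> ('M[R[i]]_(bsize n, p + bsize m) -> _).
    by apply/funext => B; apply/matrixP => i j; rewrite !mxE.
  have rE : rsubmx = mxsub id (@rshift p (bsize m)) :> ('M[R[i]]_(bsize n, p + bsize m) -> _).
    by apply/funext => B; apply/matrixP => i j; rewrite !mxE.
  apply: measurable_fun_pair; rewrite ?lE ?rE;
    by apply: (measurable_submx (T := cmx R (bsize n) (p + bsize m))); exact: measurable_id.
have mblr : measurable_fun setT ((fun w => (bl w, br w)) : T' -> (ENp * ENm)%type).
  exact: measurable_fun_pair.
pose sq (a : 'M[R[i]]_(p, p + bsize m)) := msqrt (a *m a^t*).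
have msq : measurable_fun setT (sq : cmx R p (p + bsize m) -> E1).
  apply: (measurableT_comp (@measurable_msqrt R p)).
  by apply: (measurable_gram (T := cmx R p (p + bsize m))); exact: measurable_id.
have itlr : independent2 P' (tp : T' -> cmx R p (p + bsize m))
    ((fun w => (bl w, br w)) : T' -> (ENp * ENm)%type).
  move=> A B mA mB.
  have mB' := measurable_preimageT mlr mB.
  have := itb _ _ mA mB'.
  rewrite (_ : (fun w => bottom_rows (G w)) @^-1` (lr @^-1` B) =
    (fun w => (bl w, br w)) @^-1` B); first exact.
  by apply/funext => w; rewrite /preimage /= -/(bt w) btE.
have isq : independent2 P' ((fun w => sq (tp w)) : T' -> E1)
    ((fun w => (bl w, br w)) : T' -> (ENp * ENm)%type).
  by move=> A B mA mB; exact: (itlr _ _ (measurable_preimageT msq mA) mB).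
(* the left-hand side: the first block row of Z, then its first block column *)
transitivity (P' [set w | F (corner_gram (sq (tp w)) (bl w) (br w *m (br w)^t*))]).
  pose F1 : set (E1 * (E1 * EN)) :=
    [set z | F (corner_gram z.1 (pid_mx p *m z.2.1) z.2.2)].
  pose F1' : set (E1 * (ENp * ENm)) :=
    [set z | F (corner_gram z.1 z.2.1 (z.2.2 *m z.2.2^t*))].
  have mF1 : measurable F1.
    have m2 : measurable_fun setT ((fun z => pid_mx p *m z.2.1) :
        (E1 * (E1 * EN))%type -> ENp).
      apply: (measurable_mulmx (T := (E1 * (E1 * EN))%type)); first exact: measurable_cst.
      exact: (measurableT_comp (f := fst) (g := snd) measurable_fst measurable_snd).
    exact: (measurable_corner_slice (T := (E1 * (E1 * EN))%type) mF measurable_fst m2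
      (measurableT_comp (f := snd) (g := snd) measurable_snd measurable_snd)).
  have mF1' : measurable F1'.
    have m2 : measurable_fun setT ((fun z => z.2.1) : (E1 * (ENp * ENm))%type -> ENp).
      exact: (measurableT_comp (f := fst) (g := snd) measurable_fst measurable_snd).
    have m3 : measurable_fun setT ((fun z => z.2.2 *m z.2.2^t*) :
        (E1 * (ENp * ENm))%type -> EN).
      apply: (measurable_gram (T := (E1 * (ENp * ENm))%type)).
      exact: (measurableT_comp (f := snd) (g := snd) measurable_snd measurable_snd).
    exact: (measurable_corner_slice (T := (E1 * (ENp * ENm))%type) mF measurable_fst m2 m3).
  have eg : (p * (m.+1 - 0).+1)%N = (p + bsize m)%N.
    by rewrite subn0 bsizeE -mulnS.
  have mD0 := mD 0%N isT; have mC0 := mC 0%N isT.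
  transitivity (P [set w | F1 (D 0%N w, (C 0%N w, Y w))]).
    congr (P _); apply/funext => w. 
    have E := @bidiag_gramS n (D^~ w) (C^~ w).
    rewrite /mkset. exact: (congr1 F E).
  refine (independent2_exchange (F := F1) (F' := F1') mD0
    (measurable_fun_pair mC0 mY) (measurableT_comp msq mtp) mblr iD isq _ mF1 mF1' _).
    (* D 0 has the law of the square root of the Gram matrix of the top rows *)
    move=> A mA; exact: (psd_LUE_law eg (psdD 0%N isT) (LD 0%N isT) (gaussian_top gG) mA).
  move=> s.
  pose cq (b : 'M[R[i]]_(bsize n, p)) := msqrt (b^t* *m b^t*^t*).
  have mcq : measurable_fun setT (cq : ENp -> E1).
    apply: (measurableT_comp (@measurable_msqrt R p)).
    apply: (measurable_gram (T := ENp)).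
    by apply: (measurable_adjmx (T := ENp)); exact: measurable_id.
  (* C 0 is exchanged with the square root cq (bl w), then the induction
     hypothesis applies with s and C 0 frozen *)
  transitivity (P' [set w | F (corner_gram s (pid_mx p *m cq (bl w)) (br w *m (br w)^t*))]).
    pose F2 : set (E1 * EN) := [set z | F (corner_gram s (pid_mx p *m z.1) z.2)].
    pose F2' : set (E1 * ENm) :=
      [set z | F (corner_gram s (pid_mx p *m z.1) (z.2 *m z.2^t*))].
    have mF2 : measurable F2.
      have m2 : measurable_fun setT ((fun z => pid_mx p *m z.1) : (E1 * EN)%type -> ENp).
        apply: (measurable_mulmx (T := (E1 * EN)%type)); first exact: measurable_cst.
        exact: measurable_fst.
      exact: (measurable_corner_slice (T := (E1 * EN)%type) mF
        (measurable_cst (s : E1)) m2 measurable_snd).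
    have mF2' : measurable F2'.
      have m2 : measurable_fun setT ((fun z => pid_mx p *m z.1) : (E1 * ENm)%type -> ENp).
        apply: (measurable_mulmx (T := (E1 * ENm)%type)); first exact: measurable_cst.
        exact: measurable_fst.
      have m3 : measurable_fun setT ((fun z => z.2 *m z.2^t*) : (E1 * ENm)%type -> EN).
        by apply: (measurable_gram (T := (E1 * ENm)%type)); exact: measurable_snd.
      exact: (measurable_corner_slice (T := (E1 * ENm)%type) mF
        (measurable_cst (s : E1)) m2 m3).
    have icq : independent2 P' ((fun w => cq (bl w)) : T' -> E1) (br : T' -> ENm).
      move=> A B mA mB; have mA' : measurable (cq @^-1` A : set ENp).
        by rewrite -[X in measurable X]setTI; exact: mcq.
      exact: (ilr _ _ mA' mB).
    have eg' : (p * (n.+1 - 0))%N = bsize n by rewrite subn0 bsizeE.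
    refine (independent2_exchange (F := F2) (F' := F2') mC0 mY
      (measurableT_comp mcq mbl) mbr iC icq _ mF2 mF2' _).
      move=> A mA; exact: (psd_LUE_law eg' (psdC 0%N isT) (LC 0%N isT)
        (complex_gaussian_adj (gaussian_bottom_left gG)) mA).
    move=> c; apply: (IH m nm d T P D' C' _ _ _ _ _ _ _ d' T' P' br
      (gaussian_bottom_right gG) [set y : EN | F (corner_gram s (pid_mx p *m c) y)]).
    - by move=> k kn; exact: mD.
    - by move=> k kn; exact: mC.
    - by move=> k kn; exact: psdD.
    - by move=> k kn; exact: psdC.
    - pose f (s : 'I_n.+1 + 'I_n) : 'I_n.+2 + 'I_n.+1 :=
        match s with inl k => inl (lift ord0 k) | inr k => inr (lift ord0 k) end.
      have fI : injective f.
        by move=> [k|k] [l|l] // [] kl; congr (_ _); apply/val_inj.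
      have := independent_reindex fI iDC; congr mutually_independent.
      by apply/funext => -[k|k].
    - by move=> k kn; exact: (LD k.+1).
    - by move=> k kn; exact: (LC k.+1).
    - have mid : measurable_fun setT ((fun y => y) : EN -> EN) by exact: measurable_id.
      have ms : measurable_fun setT ((fun=> s) : EN -> E1) by exact: measurable_cst.
      have mc : measurable_fun setT ((fun=> pid_mx p *m c) : EN -> ENp).
        exact: measurable_cst.
      exact: (measurable_corner_slice (T := EN) mF ms mc mid).
    - exact: corner_slice_invariant.
  (* undoing the polar form of the lower left block of G *)
  pose F3 : set (ENp * ENm) := [set z | F (corner_gram s z.1 (z.2 *m z.2^t*))].
  pose F3' : set (ENp * ENm) :=
    [set z | F (corner_gram s (pid_mx p *m cq z.1) (z.2 *m z.2^t*))].
  have m3 : measurable_fun setT ((fun z => z.2 *m z.2^t*) : (ENp * ENm)%type -> EN).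
    by apply: (measurable_gram (T := (ENp * ENm)%type)); exact: measurable_snd.
  have mF3 : measurable F3.
    exact: (measurable_corner_slice (T := (ENp * ENm)%type) mF
      (measurable_cst (s : E1)) measurable_fst m3).
  have mF3' : measurable F3'.
    have m2 : measurable_fun setT ((fun z => pid_mx p *m cq z.1) : (ENp * ENm)%type -> ENp).
      apply: (measurable_mulmx (T := (ENp * ENm)%type)); first exact: measurable_cst.
      exact: (measurableT_comp mcq measurable_fst).
    exact: (measurable_corner_slice (T := (ENp * ENm)%type) mF
      (measurable_cst (s : E1)) m2 m3).
  apply: esym; refine (independent2_exchange (F := F3) (F' := F3') mbl mbr mbl mbr
    ilr ilr _ mF3 mF3' _); first by [].
  move=> b.
  have pb : psdmx (b^t* *m b^t*^t*) by exact: gram_psd.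
  have cc : cq b *m cq b = b^t* *m b.
    apply: (etrans (sqr_msqrt pb)); exact: (congr1 (mulmx _) (trmxCK b)).
  exact: (freeze_bottom_left gG mF iF s (leq_bsize n) cc (msqrt_adj pb)).
(* undoing the polar form of the top rows of G *)
pose F4 : set (cmx R p (p + bsize m) * cmx R (bsize n) (p + bsize m)) :=
  [set z | F (col_mx z.1 z.2 *m (col_mx z.1 z.2)^t*)].
pose F4' : set (cmx R p (p + bsize m) * (ENp * ENm)) :=
  [set z | F (corner_gram (sq z.1) z.2.1 (z.2.2 *m z.2.2^t*))].
have mF4' : measurable F4'.
  have m1 : measurable_fun setT ((fun z => sq z.1) :
      (cmx R p (p + bsize m) * (ENp * ENm))%type -> E1).
    exact: (measurableT_comp msq measurable_fst).
  have m2 : measurable_fun setT ((fun z => z.2.1) :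
      (cmx R p (p + bsize m) * (ENp * ENm))%type -> ENp).
    exact: (measurableT_comp (f := fst) (g := snd) measurable_fst measurable_snd).
  have m3 : measurable_fun setT ((fun z => z.2.2 *m z.2.2^t*) :
      (cmx R p (p + bsize m) * (ENp * ENm))%type -> EN).
    apply: (measurable_gram (T := (cmx R p (p + bsize m) * (ENp * ENm))%type)).
    exact: (measurableT_comp (f := snd) (g := snd) measurable_snd measurable_snd).
  exact: (measurable_corner_slice
    (T := (cmx R p (p + bsize m) * (ENp * ENm))%type) mF m1 m2 m3).
have mF4 : measurable F4.
  pose U := (cmx R p (p + bsize m) * cmx R (bsize n) (p + bsize m))%type.
  apply: (measurable_preimageT (T := U)) mF.
  apply: (measurable_gram (T := U)); apply/(measurable_cmxP (T := U)) => i j.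
  have /(measurable_cmxP (T := U)) m1 : measurable_fun setT (fst : U -> cmx R p (p + bsize m)).
    exact: measurable_fst.
  have /(measurable_cmxP (T := U)) m2 :
    measurable_fun setT (snd : U -> cmx R (bsize n) (p + bsize m)).
    exact: measurable_snd.
  case: (split_ordP i) => k ->.
    under eq_fun do rewrite col_mxEu; exact: m1.
  under eq_fun do rewrite col_mxEd; exact: m2.
transitivity (P' [set w | F4 (tp w, bt w)]); last first.
  by congr (P' _); apply/funext => w; rewrite /F4 /mkset /= -col_mx_rows.
apply: esym; refine (independent2_exchange (F := F4) (F' := F4') mtp mbt mtp mblr
  itb itlr _ mF4 mF4' _); first by [].
move=> a.
have pa : psdmx (a *m a^t*) by exact: gram_psd.
exact: (freeze_top gG mF (sqr_msqrt pa) (msqrt_adj pa)).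
Qed.

End bidiagonal.

(** * Comparison of the two spectral measures *)

Section transport.
Variables (R : realType) (p : nat).

Lemma spectral_measure_cast N N' (e : N = N') (pN : (p <= N)%N) (pN' : (p <= N')%N)
    (X : 'M[R[i]]_N) :
  spectral_measure pN' (castmx (e, e) X) = spectral_measure pN X.
Proof. by subst N'; rewrite castmx_id (bool_irrelevance pN' pN). Qed.

Lemma castmx_gram N N' g g' (e : N = N') (f : g = g') (Z : 'M[R[i]]_(N, g)) :
  castmx (e, f) Z *m (castmx (e, f) Z)^t* = castmx (e, e) (Z *m Z^t*).
Proof. by subst N' g'; rewrite !castmx_id. Qed.

End transport.

Theorem lemma6p3 (R : realType) (p n m : nat)
  (p_gt0 : (0 < p)%N) (n_gt0 : (0 < n)%N) (le_nm : (n <= m)%N)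
  (d : measure_display) (T : measurableType d) (P : probability T R)
  (D C : nat -> T -> 'M[R[i]]_p)
  (measurable_D : forall k, (1 <= k <= n)%N ->
     measurable_fun setT (D k : T -> cmx R p p))
  (measurable_C : forall k, (1 <= k <= n - 1)%N ->
     measurable_fun setT (C k : T -> cmx R p p))
  (psd_D : forall k, (1 <= k <= n)%N -> forall w, psdmx (D k w))
  (psd_C : forall k, (1 <= k <= n - 1)%N -> forall w, psdmx (C k w))
  (independent_DC : mutually_independent P
     (fun s : 'I_n + 'I_(n - 1) =>
        (match s with inl k => D k.+1 | inr k => C k.+1 end) : T -> cmx R p p))
  (LUE_C : forall k, (1 <= k <= n - 1)%N ->
     LUE_distributed P (p * (n - k)) (fun w => C k w *m C k w))
  (LUE_D : forall k, (1 <= k <= n)%N ->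
     LUE_distributed P (p * (m - k + 1)) (fun w => D k w *m D k w))
  (d' : measure_display) (T' : measurableType d') (P' : probability T' R)
  (W : T' -> 'M[R[i]]_(p * n))
  (LUE_W : LUE_distributed P' (p * m) W) :
  let Z w := block_bidiag n (D^~ w) (C^~ w) in
  same_law P P'
    (fun w => spectral_measure (leq_sum_block p n_gt0) (Z w *m (Z w)^t*))
    (fun w => spectral_measure (leq_pmulr p n_gt0) (W w)).
Proof.
move=> Z; case: n => [//|n] in n_gt0 le_nm measurable_D measurable_C psd_D psd_C
  independent_DC LUE_C LUE_D W LUE_W Z *.
case: m => [//|m] in le_nm LUE_D LUE_W *.
pose D0 k := D k.+1; pose C0 k := C k.+1.
have mD k : (k <= n)%N -> measurable_fun setT (D0 k : T -> cmx R p p).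
  by move=> kn; exact: measurable_D.
have rangeC k : (k < n)%N -> (1 <= k.+1 <= n.+1 - 1)%N by rewrite subn1.
have mC k : (k < n)%N -> measurable_fun setT (C0 k : T -> cmx R p p).
  by move=> kn; exact/measurable_C/rangeC.
have [d0 [T0 [P0 [G [gG [mW mGG WGG]]]]]] := LUE_W.
(* the sizes p * n and p * m in the recursive form of bsize *)
pose G' w := castmx (esym (bsizeE p n), esym (bsizeE p m)) (G w).
have gG' : complex_gaussian_mx P0 G' by exact: complex_gaussian_cast.
pose pb := leq_bsize p n.
pose Y w := bidiag n (D0^~ w) (C0^~ w).
have ZE w : spectral_measure (leq_sum_block p n_gt0) (Z w *m (Z w)^t*) =
    spectral_measure pb (Y w *m (Y w)^t*).
  by rewrite /Z block_bidiagE castmx_gram; exact: spectral_measure_cast.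
have GE w : spectral_measure (leq_pmulr p n_gt0) (G w *m (G w)^t*) =
    spectral_measure pb (G' w *m (G' w)^t*).
  by apply: esym; rewrite /G' castmx_gram; exact: spectral_measure_cast.
have mY : measurable_fun setT (Y : T -> cmx R (bsize p n) (bsize p n)).
  exact: measurable_bidiag.
split.
- have -> : (fun w => spectral_measure (leq_sum_block p n_gt0) (Z w *m (Z w)^t*)) =
      spectral_measure pb \o (fun w => Y w *m (Y w)^t*) by apply/funext.
  exact: (measurableT_comp (measurable_spectral_measure pb) (measurable_gram mY)).
- exact: (measurableT_comp (measurable_spectral_measure (leq_pmulr p n_gt0)) mW).
move=> A mA.
have mS := measurable_preimageT (measurable_spectral_measure (leq_pmulr p n_gt0)) mA.
have mF := measurable_preimageT (measurable_spectral_measure pb) mA.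
rewrite /pushforward.
apply: (@etrans _ _ (P0 [set w | A (spectral_measure pb (G' w *m (G' w)^t*))])).
  apply: (@etrans _ _ (P [set w | A (spectral_measure pb (Y w *m (Y w)^t*))])).
    by congr (P _); apply/funext => w; rewrite /preimage /= ZE.
  refine (@bidiag_gram_law R p n m le_nm d T P D0 C0 mD mC _ _ _ _ _ d0 T0 P0 G' gG' (spectral_measure pb @^-1` A) mF _).
  - by move=> k kn; exact: psd_D.
  - by move=> k kn; exact/psd_C/rangeC.
  - pose f (s : 'I_n.+1 + 'I_n) : 'I_n.+1 + 'I_(n.+1 - 1) :=
      match s with inl k => inl k | inr k => inr (cast_ord (esym (subn1 n.+1)) k) end.
    have fI : injective f.
      by move=> [k|k] [l|l] // [] kl; [rewrite kl|rewrite (ord_inj kl)].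
    have := independent_reindex fI independent_DC; congr mutually_independent.
    by apply/funext => -[k|k].
  - by move=> k kn; rewrite -addn1 -subSS; exact: LUE_D.
  - by move=> k kn; rewrite -subSS; exact/LUE_C/rangeC.
  - by move=> V X fV /=; rewrite /preimage /= spectral_measure_conj.
apply: esym; apply: (etrans (WGG _ mS)).
by rewrite /pushforward; congr (P0 _); apply/funext => w; rewrite /preimage /= GE.
Qed.
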